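(* Let $k$ be an algebraically closed field of characteristic $p\geq 3$, let $G=(\mathbb{Z}/p\mathbb{Z})^2$, and let $R$ be a discrete valuation ring dominating the ring of Witt vectors $W(k)$. Suppose that $G$ is a group of $k$-automorphisms of $k[[z]]$ such that each of the subextensions of degree $p$ of $k[[z]]/k[[z]]^G$ has conductor equal to $p$ (i.e. $v_z(\sigma(z)-z)=p$ for every $\sigma\in G\setminus\{\mathrm{Id}\}$). Then $G$ cannot be lifted to a group of $R$-automorphisms of $R[[Z]]$.
   Context: $v_z$ denotes the $z$-adic valuation on $k[[z]]$. Lifting means: there is a group of $R$-automorphisms of $R[[Z]]$ isomorphic to $G$ whose reduction modulo the maximal ideal of $R$ gives the given action of $G$ on $k[[z]]$. *)

(* Defs.v *)
From HB Require Import structures.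
From mathcomp Require Import all_boot all_order all_algebra all_fingroup.
From mathcomp Require Import finmap.
From mathcomp Require Import boolp.
From mathcomp.multinomials Require Import monalg.

Set Implicit Arguments.
Unset Strict Implicit.
Unset Printing Implicit Defensive.

Import GRing.Theory.

Local Open Scope ring_scope.

Section Congruences.
Variable A : comNzRingType.
Implicit Types (m : nat) (a b c d : A).

Definition eqm m a b := exists q, a = b + m%:R * q.

Lemma eqm_refl m a : eqm m a a.
Proof. by exists 0; rewrite mulr0 addr0. Qed.

Lemma eqm_sym m a b : eqm m a b -> eqm m b a.
Proof. by case=> q ->; exists (- q); rewrite mulrN addrK. Qed.

Lemma eqm_trans m a b c : eqm m a b -> eqm m b c -> eqm m a c.
Proof. by case=> q -> [r ->]; exists (r + q); rewrite mulrDr addrA. Qed.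

Lemma eqmD m a b c d : eqm m a b -> eqm m c d -> eqm m (a + c) (b + d).
Proof. by case=> q -> [r ->]; exists (q + r); rewrite mulrDr addrACA. Qed.

Lemma eqmN m a b : eqm m a b -> eqm m (- a) (- b).
Proof. by case=> q ->; exists (- q); rewrite mulrN opprD. Qed.

Lemma eqmM m a b c d : eqm m a b -> eqm m c d -> eqm m (a * c) (b * d).
Proof.
case=> q -> [r ->]; exists (q * d + b * r + q * (m%:R * r)).
by rewrite mulrDl !mulrDr -!addrA; congr (_ + _); rewrite [RHS]addrCA mulrCA
  !mulrA.
Qed.

Lemma eqmX m a b n : eqm m a b -> eqm m (a ^+ n) (b ^+ n).
Proof.
move=> ab; elim: n => [|n IHn]; first by rewrite !expr0; apply: eqm_refl.
by rewrite !exprS; apply: eqmM.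
Qed.

Lemma eqm_sum m (I : Type) (r : seq I) (F G : I -> A) :
  (forall i, eqm m (F i) (G i)) -> eqm m (\sum_(i <- r) F i) (\sum_(i <- r) G i).
Proof.
move=> FG; apply: (big_ind2 (eqm m)) => //; first exact: eqm_refl.
by move=> *; apply: eqmD.
Qed.

Lemma eqm_scale m n a b : eqm n a b -> eqm (m * n) (m%:R * a) (m%:R * b).
Proof. by case=> q ->; exists q; rewrite mulrDr natrM mulrA. Qed.

Lemma eqm_dvd m n a b : (m %| n)%N -> eqm n a b -> eqm m a b.
Proof. by move=> /dvdnP[k ->] [q ->]; exists (k%:R * q); rewrite natrM mulrA [m%:R * _]mulrC. Qed.

Lemma eqm_expS p j a b :
  eqm (p ^ j.+1) a b -> eqm (p ^ j.+2) (a ^+ p) (b ^+ p).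
Proof.
move=> ab; have ab1 : eqm p a b by apply: eqm_dvd ab; rewrite expnS dvdn_mulr.
have [s Hs] : eqm p (\sum_(i < p) a ^+ (p.-1 - i) * b ^+ i) 0.
  apply: eqm_trans (_ : eqm p (\sum_(i < p) b ^+ p.-1) _).
    apply: eqm_sum => i; have le_ip : (i <= p.-1)%N.
      by rewrite -ltnS prednK ?(ltn_ord i) // (leq_trans _ (ltn_ord i)).
    rewrite -[X in eqm _ _ (_ ^+ X)](subnK le_ip) exprD; apply: eqmM; last exact: eqm_refl.
    exact: eqmX.
  rewrite sumr_const card_ord; exists (b ^+ p.-1).
  by rewrite add0r mulr_natl.
case: ab => q Hq; exists (q * s); apply/eqP; rewrite -subr_eq0 opprD addrA subr_eq0.
have := subrXX a b p; rewrite Hs add0r => ->.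
by rewrite {1}Hq addrC addKr [(p ^ j.+2)%N]expnSr natrM mulrACA.
Qed.

Lemma eqm_expX p j n a b :
  eqm (p ^ j.+1) a b -> eqm (p ^ (j + n).+1) (a ^+ (p ^ n)) (b ^+ (p ^ n)).
Proof.
move=> ab; elim: n => [|n IHn]; first by rewrite addn0 !expr1.
by rewrite addnS [(p ^ n.+1)%N]expnSr !exprM; apply: eqm_expS.
Qed.

Lemma eqm_exprD p a b : prime p -> eqm p ((a + b) ^+ p) (a ^+ p + b ^+ p).
Proof.
case: p => // p p_pr; rewrite exprDn big_ord_recl big_ord_recr /=.
rewrite subn0 bin0 mulr1n expr0 mulr1 /bump /= add1n subnn binn expr0 mul1r mulr1n.
rewrite addrA addrAC; apply: (@eqm_trans _ _ (a ^+ p.+1 + b ^+ p.+1 + 0)); last first.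
  by rewrite addr0; apply: eqm_refl.
apply: eqmD; first exact: eqm_refl.
apply: eqm_trans (_ : eqm p.+1 (\sum_(i < p) 0) 0); last first.
  by rewrite big1 //; apply: eqm_refl.
apply: eqm_sum => i.
have /dvdnP[c ->] : (p.+1 %| 'C(p.+1, (1 + i)))%N.
  by rewrite prime_dvd_bin //= add1n ltnS.
by rewrite mulrnA -mulr_natl -[X in eqm _ X]add0r; eexists.
Qed.

End Congruences.

Lemma eqm_int_expr p (c : int) : prime p -> eqm p (c ^+ p) c.
Proof.
move=> p_pr; have p_gt0 := prime_gt0 p_pr.
have nat_case (n : nat) : eqm p ((n%:Z) ^+ p) n%:Z.
  elim: n => [|n IHn]; first by rewrite expr0n gtn_eqF //; apply: eqm_refl.
  rewrite -addn1 PoszD; apply: eqm_trans (eqm_exprD _ _ p_pr) _.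
  by apply: eqmD => //; rewrite expr1n; apply: eqm_refl.
case: c => [n|n]; first exact: nat_case.
rewrite NegzE; set m := n.+1.
have := eqm_exprD m%:Z (- m%:Z) p_pr; rewrite subrr expr0n gtn_eqF //.
move=> /eqm_sym h.
have := eqmD (eqmN (nat_case m)) h; rewrite addr0 addKr; exact.
Qed.

(** The ring of integer polynomials in the variables [wvar (j, i)]; the index
    [j] numbers the Witt vectors and [i] their components. *)
Notation wpoly := {malg int[{cmonom (nat * nat)%type}]}.

Definition wvar (ji : nat * nat) : wpoly := << ucm ji >>.

Section Evaluation.
Variables (A : comNzRingType) (e : nat * nat -> A).

Definition wmeval (m : {cmonom (nat * nat)%type}) : A :=
  \prod_(i <- finsupp m) e i ^+ m i.

Lemma wmevalEw (d : {fset (nat * nat)%type}) (m : {cmonom (nat * nat)%type}) :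
  (finsupp m `<=` d)%fset -> wmeval m = \prod_(i <- d) e i ^+ m i.
Proof.
move=> le; rewrite /wmeval (big_fset_incl _ le) //.
by move=> i i_in_d; rewrite -cmE_neq0 negbK => /eqP ->.
Qed.

Lemma wmeval_mmorphism : mmorphism wmeval.
Proof.
split; last by rewrite /wmeval mdom1 big_seq_fset0.
move=> m1 m2; rewrite /wmeval mdomD.
rewrite -!/(wmeval _) (wmevalEw (fsubsetUl _ (finsupp m2))).
rewrite (wmevalEw (fsubsetUr (finsupp m1) _)) -big_split /=.
by apply: eq_bigr => i _; rewrite cmM exprD.
Qed.

HB.instance Definition _ :=
  isMultiplicative.Build {cmonom (nat * nat)%type} A wmeval wmeval_mmorphism.

Definition weval : {rmorphism wpoly -> A} := mmap intr wmeval.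

Lemma weval_var ji : weval (wvar ji) = e ji.
Proof. by rewrite /weval /wvar /= mmapU mul1r /wmeval mdomU big_seq_fset1 cmUU. Qed.

End Evaluation.

Lemma rmorph_weval (A B : comNzRingType) (f : {rmorphism A -> B}) e g :
  f (weval e g) = weval (f \o e) g.
Proof.
rewrite /weval /= !mmapE rmorph_sum; apply: eq_bigr => m _.
rewrite rmorphM rmorph_int rmorph_prod; congr (_ * _).
by apply: eq_bigr => i _; rewrite rmorphXn.
Qed.

Lemma eq_weval (A : comNzRingType) (e e' : nat * nat -> A) g :
  e =1 e' -> weval e g = weval e' g.
Proof. by move=> /funext ->. Qed.

Lemma eqm_sum_expr p (A : comNzRingType) (I : Type) (r : seq I) (c : I -> int)
    (F : I -> A) : prime p ->
  eqm p ((\sum_(i <- r) (c i)%:~R * F i) ^+ p) (\sum_(i <- r) (c i)%:~R * F i ^+ p).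
Proof.
move=> p_pr; elim: r => [|i r IHr].
  by rewrite !big_nil expr0n gtn_eqF ?prime_gt0 //; apply: eqm_refl.
rewrite !big_cons; apply: eqm_trans (eqm_exprD _ _ p_pr) _.
apply: eqmD => //; rewrite exprMn; apply: eqmM; last exact: eqm_refl.
rewrite -rmorphXn /=; have [q ->] := eqm_int_expr (c i) p_pr.
by exists q%:~R; rewrite rmorphD rmorphM /= rmorph_nat.
Qed.

Lemma wmeval_wvar (m : {cmonom (nat * nat)%type}) : wmeval wvar m = << m >>.
Proof.
pose cm i := iter (m i) (mmul (ucm i)) (mone : {cmonom (nat * nat)%type}).
have UM (m1 m2 : {cmonom (nat * nat)%type}) :
    << mmul m1 m2 >> = << m1 >> * << m2 >> :> wpoly.
  by rewrite malgM_def fgmulUU mulr1.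
have cmP i : wvar i ^+ m i = << cm i >>.
  rewrite /cm; elim: (m i) => [|n IHn]; first by rewrite expr0.
  by rewrite exprS IHn iterS UM.
have cmE i j : cm i j = (m i * (i == j))%N.
  rewrite /cm; elim: (m i) => [|n IHn]; first by rewrite /= cm1.
  by rewrite iterS cmM cmU IHn mulSn.
rewrite /wmeval (eq_bigr _ (fun i _ => cmP i)).
rewrite -(big_morph (fun m : {cmonom (nat * nat)%type} => << m >> : wpoly) UM (erefl _)).
congr << _ >>; apply/eqP/monalg.cmP => j.
rewrite (big_morph (fun m : {cmonom (nat * nat)%type} => m j) (fun m1 m2 => cmM j m1 m2) (cm1 j)).
rewrite (eq_bigr _ (fun i _ => cmE i j)).
case: (mdomP m j) => [jm|jNm].
  rewrite (big_fsetD1 j) //= eqxx muln1 big1_fset ?addn0 // => i.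
  by rewrite in_fsetD1 => /andP[/negPf ->]; rewrite muln0.
rewrite big1_fset // => i im _; case: eqP => [ij|_]; last by rewrite muln0.
by rewrite -ij im in jNm.
Qed.

Lemma weval_wvar g : weval wvar g = g.
Proof.
rewrite [RHS]monalgE /weval /= mmapE; apply: eq_bigr => m _.
by rewrite wmeval_wvar mulrzl -(raddfMz (mkmalgU m)) intz.
Qed.

Section WittPolynomials.
Variables (p : nat) (p_pr : prime p).

(** The ghost components, i.e. the values of the Witt polynomials. *)
Definition ghost (A : comNzRingType) (x : nat -> A) n : A :=
  \sum_(i < n.+1) (p ^ i)%:R * x i ^+ (p ^ (n - i)).

Definition ghost_trunc (A : comNzRingType) (x : nat -> A) n : A :=
  \sum_(i < n) (p ^ i)%:R * x i ^+ (p ^ (n - i)).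

Lemma ghostE (A : comNzRingType) (x : nat -> A) n :
  ghost x n = ghost_trunc x n + (p ^ n)%:R * x n.
Proof. by rewrite /ghost big_ord_recr /= subnn expr1. Qed.

Lemma rmorph_ghost (A B : comNzRingType) (f : {rmorphism A -> B}) x n :
  f (ghost x n) = ghost (f \o x) n.
Proof.
rewrite /ghost rmorph_sum; apply: eq_bigr => i _.
by rewrite rmorphM rmorph_nat rmorphXn.
Qed.

(** Coefficientwise quotient; it is only used for exact divisions. *)
Definition wdiv (g : wpoly) (d : int) : wpoly :=
  [malg k in msupp g => (g@_k %/ d)%Z].

(** [unghost w] is the sequence whose ghost components are the [w n], when
    there is one: [w n = ghost_trunc (unghost w) n + p ^ n * unghost w n]. *)
Fixpoint unghost_seq (w : nat -> wpoly) (n : nat) : seq wpoly :=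
  if n is m.+1 then
    let s := unghost_seq w m in
    rcons s (wdiv (w m - ghost_trunc (nth 0 s) m) (p ^ m)%N)
  else [::].

Definition unghost w n : wpoly := nth 0 (unghost_seq w n.+1) n.

Lemma size_unghost_seq w n : size (unghost_seq w n) = n.
Proof. by elim: n => //= n IHn; rewrite size_rcons IHn. Qed.

Lemma nth_unghost_seq w n i : (i < n)%N -> nth 0 (unghost_seq w n) i = unghost w i.
Proof.
elim: n => // n IHn; rewrite ltnS leq_eqVlt => /predU1P[->//|lt_in].
by rewrite /= nth_rcons size_unghost_seq lt_in IHn.
Qed.

Lemma unghostE w n :
  unghost w n = wdiv (w n - ghost_trunc (unghost w) n) (p ^ n)%N.
Proof.
rewrite {1}/unghost /= nth_rcons size_unghost_seq ltnn eqxx.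
have -> // : ghost_trunc (nth 0 (unghost_seq w n)) n = ghost_trunc (unghost w) n.
by apply: eq_bigr => i _; rewrite nth_unghost_seq.
Qed.

Lemma mcoeff_natM (d : nat) (g : wpoly) k : (d%:R * g)@_k = d%:R * g@_k.
Proof. by rewrite mulr_natl mcoeffMn mulr_natl. Qed.

Lemma wpoly_natI (d : nat) (g h : wpoly) : (0 < d)%N -> d%:R * g = d%:R * h -> g = h.
Proof.
move=> d_gt0 gh; apply/malgP => k; have nzd : (d%:R : int) != 0 by rewrite Num.Theory.pnatr_eq0 -lt0n.
have Eg := mcoeff_natM d g k.
have Eh := mcoeff_natM d h k.
have E : d%:R * g@_k = d%:R * h@_k.
  etransitivity; first by symmetry; exact Eg.
  etransitivity; last by exact Eh.
  by rewrite gh.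
exact: (mulfI nzd E).
Qed.

Lemma wdivK (d : nat) g : (0 < d)%N -> wdiv (d%:R * g) d = g.
Proof.
move=> d_gt0; apply/malgP => k; rewrite mcoeffE.
have -> : (if k \in msupp (d%:R * g) then ((d%:R * g)@_k %/ d)%Z else 0)
    = ((d%:R * g)@_k %/ d)%Z.
  by case: msuppP => // _; rewrite div0z.
by rewrite mcoeff_natM natz mulrC mulzK // eqz_nat -lt0n.
Qed.

Lemma wdiv_exact (d : nat) g t q : (0 < d)%N ->
  g = t + d%:R * q -> t + d%:R * wdiv (g - t) d = g.
Proof.
move=> d_gt0 Eg; have Et : g - t = d%:R * q by rewrite Eg addrC addKr.
by rewrite Et wdivK // -Eg.
Qed.

Definition wfrob : {rmorphism wpoly -> wpoly} := weval (fun ji => wvar ji ^+ p).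

Lemma eqm_wfrob (g : wpoly) : eqm p (g ^+ p) (wfrob g).
Proof.
have Eg : g = \sum_(m <- msupp g) (g@_m)%:~R * wmeval wvar m.
  exact: esym (weval_wvar g).
have EX m : wmeval (fun ji => wvar ji ^+ p) m = wmeval wvar m ^+ p.
  rewrite /wmeval -prodrXl; apply: eq_bigr => i _; exact: exprAC.
have Ef : wfrob g = \sum_(m <- msupp g) (g@_m)%:~R * wmeval wvar m ^+ p.
  exact: eq_bigr (fun m _ => congr1 (fun u => (g@_m)%:~R * u) (EX m)).
rewrite {}Ef [in X in eqm _ X _]Eg => {Eg}.
exact: eqm_sum_expr.
Qed.

Lemma eqm_ghostS (x : nat -> wpoly) n :
  eqm (p ^ n.+1) (ghost_trunc x n.+1) (wfrob (ghost x n)).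
Proof.
rewrite rmorph_ghost; apply: eqm_sum => i.
have le_in : (i <= n)%N by rewrite -ltnS.
have -> : (p ^ n.+1 = p ^ i * p ^ (0 + (n - i)).+1)%N.
  by rewrite -expnD add0n addnS subnKC.
apply: eqm_scale; rewrite subSn //.
have xi : eqm (p ^ 1) (x i ^+ p) (wfrob (x i)).
  by rewrite expn1; exact: eqm_wfrob.
by have := eqm_expX (n - i) xi; rewrite -exprM -[(p * p ^ _)%N]expnS; exact.
Qed.

Definition dwork (w : nat -> wpoly) :=
  forall n, eqm (p ^ n.+1) (w n.+1) (wfrob (w n)).

Lemma dwork_ghost x : dwork (ghost x).
Proof.
move=> n; rewrite ghostE; have [q ->] := eqm_ghostS x n.
by exists (q + x n.+1); rewrite mulrDr addrA.
Qed.

Lemma dworkD w w' : dwork w -> dwork w' -> dwork (fun n => w n + w' n).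
Proof. by move=> dw dw' n; rewrite rmorphD; apply: eqmD. Qed.

Lemma dworkM w w' : dwork w -> dwork w' -> dwork (fun n => w n * w' n).
Proof. by move=> dw dw' n; rewrite rmorphM; apply: eqmM. Qed.

Lemma dworkN w : dwork w -> dwork (fun n => - w n).
Proof. by move=> dw n; rewrite rmorphN; apply: eqmN. Qed.

Lemma unghostK w : dwork w -> forall n, ghost (unghost w) n = w n.
Proof.
move=> dw; elim=> [|n IHn]; rewrite ghostE unghostE.
  by apply: (@wdiv_exact 1 _ _ (w 0%N)); rewrite // /ghost_trunc big_ord0 add0r mul1r.
have [q Hq] : eqm (p ^ n.+1) (w n.+1) (ghost_trunc (unghost w) n.+1).
  by apply: eqm_trans (dw n) _; rewrite -IHn; apply/eqm_sym/eqm_ghostS.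
by apply: wdiv_exact Hq; rewrite expn_gt0 prime_gt0.
Qed.

Lemma ghost_inj (x y : nat -> wpoly) : ghost x =1 ghost y -> x =1 y.
Proof.
move=> xy n; elim/ltn_ind: n => n IHn; have := xy n; rewrite !ghostE.
have -> : ghost_trunc x n = ghost_trunc y n.
  by apply: eq_bigr => i _; rewrite IHn.
by move/addrI; apply: wpoly_natI; rewrite expn_gt0 prime_gt0.
Qed.

(** The polynomials giving sum, product and opposite of Witt vectors:
    the two arguments are the sequences [wvar (0, i)] and [wvar (1, i)]. *)
Definition wvec j : nat -> wpoly := fun i => wvar (j, i).
Definition waddp := unghost (fun n => ghost (wvec 0) n + ghost (wvec 1) n).
Definition wmulp := unghost (fun n => ghost (wvec 0) n * ghost (wvec 1) n).
Definition woppp := unghost (fun n => - ghost (wvec 0) n).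

End WittPolynomials.

(** [witt p_pr A] is the ring of p-typical Witt vectors of [A], [x n] being the
    n-th Witt component of [x]. *)
Definition witt (p : nat) (p_pr : prime p) (A : Type) := nat -> A.

Section WittRing.
Variables (p : nat) (p_pr : prime p).

Section Operations.
Variable A : comNzRingType.
Implicit Types x y : witt p_pr A.

Definition witt_eval x y : {rmorphism wpoly -> A} :=
  weval (fun ji => if ji.1 == 0%N then x ji.2 else y ji.2).

Definition witt_zero : witt p_pr A := fun=> 0.
Definition witt_one : witt p_pr A := fun n => (n == 0%N)%:R.
Definition witt_add x y : witt p_pr A := fun n => witt_eval x y (waddp p n).
Definition witt_mul x y : witt p_pr A := fun n => witt_eval x y (wmulp p n).
Definition witt_opp x : witt p_pr A := fun n => witt_eval x x (woppp p n).

Let eval0 x y n : witt_eval x y (ghost p (wvec 0) n) = ghost p x n.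
Proof.
rewrite rmorph_ghost; congr ghost; apply: funext => i.
by rewrite /= weval_var.
Qed.

Let eval1 x y n : witt_eval x y (ghost p (wvec 1) n) = ghost p y n.
Proof.
rewrite rmorph_ghost; congr ghost; apply: funext => i.
by rewrite /= weval_var.
Qed.

Lemma ghost_zero n : ghost p witt_zero n = 0.
Proof.
rewrite /ghost big1 // => i _; rewrite expr0n expn_eq0 (gtn_eqF (prime_gt0 p_pr)).
by rewrite mulr0.
Qed.

Lemma ghost_one n : ghost p witt_one n = 1.
Proof.
rewrite /ghost big_ord_recl big1 ?addr0 => [|i _]; last first.
  by rewrite expr0n expn_eq0 (gtn_eqF (prime_gt0 p_pr)) mulr0.
by rewrite expn0 mul1r expr1n.
Qed.

Let ghost_eval x y w n : dwork p w ->
  ghost p (fun m => witt_eval x y (unghost p w m)) n = witt_eval x y (w n).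
Proof.
move=> dw; rewrite -(unghostK p_pr dw n); exact: esym (rmorph_ghost p _ _ n).
Qed.

Lemma ghost_add x y n : ghost p (witt_add x y) n = ghost p x n + ghost p y n.
Proof.
have dw := dworkD (dwork_ghost p_pr (wvec 0)) (dwork_ghost p_pr (wvec 1)).
rewrite -(eval0 x y n) -[in RHS](eval1 x y n) -rmorphD.
exact: ghost_eval dw.
Qed.

Lemma ghost_mul x y n : ghost p (witt_mul x y) n = ghost p x n * ghost p y n.
Proof.
have dw := dworkM (dwork_ghost p_pr (wvec 0)) (dwork_ghost p_pr (wvec 1)).
rewrite -(eval0 x y n) -[in RHS](eval1 x y n) -rmorphM.
exact: ghost_eval dw.
Qed.

Lemma ghost_opp x n : ghost p (witt_opp x) n = - ghost p x n.
Proof.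
have dw := dworkN (dwork_ghost p_pr (wvec 0)).
rewrite -(eval0 x x n) -rmorphN.
exact: ghost_eval dw.
Qed.

End Operations.

Section Functoriality.
Variables (A B : comNzRingType) (f : {rmorphism A -> B}).
Implicit Types x y : witt p_pr A.

Definition witt_map x : witt p_pr B := f \o x.

Let evalE x y g : f (witt_eval x y g) = witt_eval (witt_map x) (witt_map y) g.
Proof.
by rewrite rmorph_weval; apply: eq_weval => -[j i] /=; case: (j == 0%N).
Qed.

Lemma witt_map_zero : witt_map (witt_zero A) = witt_zero B.
Proof. by apply: funext => n; exact: rmorph0 f. Qed.

Lemma witt_map_one : witt_map (witt_one A) = witt_one B.
Proof. by apply: funext => n; exact: rmorph_nat f _. Qed.

Lemma witt_map_add x y :
  witt_map (witt_add x y) = witt_add (witt_map x) (witt_map y).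
Proof. by apply: funext => n; apply: evalE. Qed.

Lemma witt_map_mul x y :
  witt_map (witt_mul x y) = witt_mul (witt_map x) (witt_map y).
Proof. by apply: funext => n; apply: evalE. Qed.

Lemma witt_map_opp x : witt_map (witt_opp x) = witt_opp (witt_map x).
Proof. by apply: funext => n; apply: evalE. Qed.

End Functoriality.

(** The ring axioms hold when the ghost map is injective, in particular over the
    polynomial ring, and then over any ring by specialisation of the variables. *)
Section GhostInjective.
#[local] Opaque witt_map witt_add witt_mul witt_opp witt_zero witt_one.
Variable U : comNzRingType.
Hypothesis ghostI : forall u v : witt p_pr U, ghost p u =1 ghost p v -> u = v.
Variables X Y Z : witt p_pr U.

Let addA : witt_add X (witt_add Y Z) = witt_add (witt_add X Y) Z.
Proof. by apply: ghostI => n; rewrite !ghost_add addrA. Qed.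

Let addC : witt_add X Y = witt_add Y X.
Proof. by apply: ghostI => n; rewrite !ghost_add addrC. Qed.

Let add0 : witt_add (witt_zero U) X = X.
Proof. by apply: ghostI => n; rewrite ghost_add ghost_zero add0r. Qed.

Let addN : witt_add (witt_opp X) X = witt_zero U.
Proof. by apply: ghostI => n; rewrite ghost_add ghost_opp ghost_zero addNr. Qed.

Let mulA : witt_mul X (witt_mul Y Z) = witt_mul (witt_mul X Y) Z.
Proof. by apply: ghostI => n; rewrite !ghost_mul mulrA. Qed.

Let mulC : witt_mul X Y = witt_mul Y X.
Proof. by apply: ghostI => n; rewrite !ghost_mul mulrC. Qed.

Let mul1 : witt_mul (witt_one U) X = X.
Proof. by apply: ghostI => n; rewrite ghost_mul ghost_one mul1r. Qed.

Let mulDl :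
  witt_mul (witt_add X Y) Z = witt_add (witt_mul X Z) (witt_mul Y Z).
Proof.
by apply: ghostI => n; rewrite ghost_mul (ghost_add X Y) ghost_add 2!ghost_mul mulrDl.
Qed.

Variables (A : comNzRingType) (f : {rmorphism U -> A}).
Variables x y z : witt p_pr A.
Hypotheses (fX : witt_map f X = x) (fY : witt_map f Y = y) (fZ : witt_map f Z = z).

Lemma witt_axioms_map :
  [/\ witt_add x (witt_add y z) = witt_add (witt_add x y) z,
      witt_add x y = witt_add y x,
      witt_add (witt_zero A) x = x &
      witt_add (witt_opp x) x = witt_zero A] /\
  [/\ witt_mul x (witt_mul y z) = witt_mul (witt_mul x y) z,
      witt_mul x y = witt_mul y x,
      witt_mul (witt_one A) x = x &
      witt_mul (witt_add x y) z = witt_add (witt_mul x z) (witt_mul y z)].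
Proof.
have D u v : witt_add (witt_map f u) (witt_map f v) = witt_map f (witt_add u v).
  exact: esym (witt_map_add f u v).
have M u v : witt_mul (witt_map f u) (witt_map f v) = witt_map f (witt_mul u v).
  exact: esym (witt_map_mul f u v).
rewrite -fX -fY -fZ; split; split.
- by rewrite (D Y Z) (D X (witt_add Y Z)) (D X Y) (D (witt_add X Y) Z) addA.
- by rewrite (D X Y) (D Y X) addC.
- by rewrite -(witt_map_zero f) (D (witt_zero U) X) add0.
- by rewrite -(witt_map_zero f) -(witt_map_opp f X) (D (witt_opp X) X) addN.
- by rewrite (M Y Z) (M X (witt_mul Y Z)) (M X Y) (M (witt_mul X Y) Z) mulA.
- by rewrite (M X Y) (M Y X) mulC.
- by rewrite -(witt_map_one f) (M (witt_one U) X) mul1.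
- by rewrite (D X Y) (M (witt_add X Y) Z) (M X Z) (M Y Z)
    (D (witt_mul X Z) (witt_mul Y Z)) mulDl.
Qed.

End GhostInjective.

Section RingLaws.
Variable A : comNzRingType.
Implicit Types x y z : witt p_pr A.

Let witt_axioms x y z :
  [/\ witt_add x (witt_add y z) = witt_add (witt_add x y) z,
      witt_add x y = witt_add y x,
      witt_add (witt_zero A) x = x &
      witt_add (witt_opp x) x = witt_zero A] /\
  [/\ witt_mul x (witt_mul y z) = witt_mul (witt_mul x y) z,
      witt_mul x y = witt_mul y x,
      witt_mul (witt_one A) x = x &
      witt_mul (witt_add x y) z = witt_add (witt_mul x z) (witt_mul y z)].
Proof.
pose f : {rmorphism wpoly -> A} :=
  weval (fun ji => nth 0 [:: x ji.2; y ji.2; z ji.2] ji.1).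
have fE j : (fun i => f (wvec j i)) = fun i => nth 0 [:: x i; y i; z i] j.
  by apply: funext => i; exact: weval_var.
exact: (@witt_axioms_map _ (fun u v uv => funext (ghost_inj p_pr uv))
  (wvec 0) (wvec 1) (wvec 2) A f x y z (fE 0%N) (fE 1%N) (fE 2%N)).
Qed.

Lemma witt_addA : associative (@witt_add A).
Proof. by move=> x y z; case: (witt_axioms x y z) => -[]. Qed.

Lemma witt_addC : commutative (@witt_add A).
Proof. by move=> x y; case: (witt_axioms x y x) => -[]. Qed.

Lemma witt_add0 : left_id (@witt_zero A) (@witt_add A).
Proof. by move=> x; case: (witt_axioms x x x) => -[]. Qed.

Lemma witt_addN :
  left_inverse (@witt_zero A) (@witt_opp A) (@witt_add A).
Proof. by move=> x; case: (witt_axioms x x x) => -[]. Qed.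

Lemma witt_mulA : associative (@witt_mul A).
Proof. by move=> x y z; case: (witt_axioms x y z) => _ []. Qed.

Lemma witt_mulC : commutative (@witt_mul A).
Proof. by move=> x y; case: (witt_axioms x y x) => _ []. Qed.

Lemma witt_mul1 : left_id (@witt_one A) (@witt_mul A).
Proof. by move=> x; case: (witt_axioms x x x) => _ []. Qed.

Lemma witt_mulDl :
  left_distributive (@witt_mul A) (@witt_add A).
Proof. by move=> x y z; case: (witt_axioms x y z) => _ []. Qed.

Lemma witt_one_neq0 : witt_one A <> witt_zero A.
Proof. by move/(congr1 (fun x => x 0%N))/eqP; rewrite oner_eq0. Qed.

End RingLaws.

End WittRing.

HB.instance Definition _ p (p_pr : prime p) A := gen_eqMixin (witt p_pr A).
HB.instance Definition _ p (p_pr : prime p) A := gen_choiceMixin (witt p_pr A).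
HB.instance Definition _ p (p_pr : prime p) (A : comNzRingType) :=
  GRing.isZmodule.Build (witt p_pr A) (@witt_addA p p_pr A)
    (@witt_addC p p_pr A) (@witt_add0 p p_pr A) (@witt_addN p p_pr A).
Fact witt_oner_neq0 p (p_pr : prime p) (A : comNzRingType) :
  witt_one p_pr A != 0.
Proof. exact/eqP/witt_one_neq0. Qed.
HB.instance Definition _ p (p_pr : prime p) (A : comNzRingType) :=
  GRing.Zmodule_isComNzRing.Build (witt p_pr A) (@witt_mulA p p_pr A)
    (@witt_mulC p p_pr A) (@witt_mul1 p p_pr A) (@witt_mulDl p p_pr A)
    (@witt_oner_neq0 p p_pr A).

#[global] Opaque waddp wmulp woppp.

(** The residue map [W(A) -> A], i.e. the component of index 0. *)
Definition witt_res p (p_pr : prime p) (A : comNzRingType) (x : witt p_pr A) : A :=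
  x 0%N.

Section WittResidue.
Variables (p : nat) (p_pr : prime p) (A : comNzRingType).

Let ghost0 (x : witt p_pr A) : ghost p x 0 = witt_res x.
Proof. by rewrite /ghost big_ord1 mul1r expr1. Qed.

Fact witt_res_is_additive : {morph @witt_res p p_pr A : x y / x - y}.
Proof.
move=> x y; rewrite -!ghost0 -ghost_opp; exact: ghost_add.
Qed.

Fact witt_res_is_monoid_morphism : monoid_morphism (@witt_res p p_pr A).
Proof. by split=> // x y; rewrite -!ghost0; exact: ghost_mul. Qed.

HB.instance Definition _ :=
  GRing.isZmodMorphism.Build (witt p_pr A) A (@witt_res p p_pr A)
    witt_res_is_additive.
HB.instance Definition _ :=
  GRing.isMonoidMorphism.Build (witt p_pr A) A (@witt_res p p_pr A)
    witt_res_is_monoid_morphism.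

End WittResidue.

(** [pseries A] is the ring A[[z]]; [f n] is the coefficient of z^n in [f]. *)
Definition pseries (A : Type) := nat -> A.

HB.instance Definition _ A := gen_eqMixin (pseries A).
HB.instance Definition _ A := gen_choiceMixin (pseries A).

Section PowerSeriesRing.
Variable A : comNzRingType.
Implicit Types f g h : pseries A.

Definition ps_zero : pseries A := fun=> 0.
Definition ps_one : pseries A := fun n => (n == 0%N)%:R.
Definition ps_add f g : pseries A := fun n => f n + g n.
Definition ps_opp f : pseries A := fun n => - f n.
Definition ps_mul f g : pseries A := fun n => \sum_(j < n.+1) f j * g (n - j)%N.
Definition ps_scale (a : A) f : pseries A := fun n => a * f n.

Let trunc N f : {poly A} := \poly_(i < N) f i.

Let coef_mul N f g n : (n < N)%N -> ps_mul f g n = (trunc N f * trunc N g)`_n.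
Proof.
move=> lt_nN; rewrite coefM; apply: eq_bigr => j _.
have le_jn : (j <= n)%N by rewrite -ltnS.
by rewrite !coef_poly (leq_ltn_trans le_jn lt_nN) (leq_ltn_trans (leq_subr _ _) lt_nN).
Qed.

Let coef_mulT N f (q : {poly A}) n : (n < N)%N ->
  \sum_(j < n.+1) f j * q`_(n - j) = (trunc N f * q)`_n.
Proof.
move=> lt_nN; rewrite coefM; apply: eq_bigr => j _.
have le_jn : (j <= n)%N by rewrite -ltnS.
by rewrite coef_poly (leq_ltn_trans le_jn lt_nN).
Qed.

Fact ps_addA : associative ps_add.
Proof. by move=> f g h; apply: funext => n; apply: addrA. Qed.
Fact ps_addC : commutative ps_add.
Proof. by move=> f g; apply: funext => n; apply: addrC. Qed.
Fact ps_add0 : left_id ps_zero ps_add.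
Proof. by move=> f; apply: funext => n; apply: add0r. Qed.
Fact ps_addN : left_inverse ps_zero ps_opp ps_add.
Proof. by move=> f; apply: funext => n; apply: addNr. Qed.

Fact ps_mulC : commutative ps_mul.
Proof.
by move=> f g; apply: funext => n; rewrite !(@coef_mul n.+1) // mulrC.
Qed.

Fact ps_mulA : associative ps_mul.
Proof.
have mulE f g h n : ps_mul f (ps_mul g h) n
    = (trunc n.+1 f * (trunc n.+1 g * trunc n.+1 h))`_n.
  rewrite -coef_mulT //; apply: eq_bigr => j _; rewrite (@coef_mul n.+1) //.
  by rewrite ltnS leq_subr.
move=> f g h; apply: funext => n.
by rewrite [RHS](congr1 (fun s => s n) (ps_mulC _ _)) !mulE mulrA mulrC.
Qed.

Fact ps_mul1 : left_id ps_one ps_mul.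
Proof.
move=> f; apply: funext => n; rewrite /ps_mul big_ord_recl big1 => [|j _].
  by rewrite addr0 mul1r subn0.
by rewrite mul0r.
Qed.

Fact ps_mulDl : left_distributive ps_mul ps_add.
Proof.
move=> f g h; apply: funext => n; rewrite /ps_add /ps_mul -big_split.
by apply: eq_bigr => j _; rewrite mulrDl.
Qed.

HB.instance Definition _ := GRing.isZmodule.Build (pseries A)
  ps_addA ps_addC ps_add0 ps_addN.

Fact ps_oner_neq0 : ps_one != 0.
Proof.
by apply/eqP => /(congr1 (fun f : pseries A => f 0%N))/eqP; rewrite oner_eq0.
Qed.

HB.instance Definition _ := GRing.Zmodule_isComNzRing.Build (pseries A)
  ps_mulA ps_mulC ps_mul1 ps_mulDl ps_oner_neq0.

Fact ps_scaleA a b f : ps_scale a (ps_scale b f) = ps_scale (a * b) f.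
Proof. by apply: funext => n; apply: mulrA. Qed.
Fact ps_scale1 : left_id 1 ps_scale.
Proof. by move=> f; apply: funext => n; apply: mul1r. Qed.
Fact ps_scaleDr : right_distributive ps_scale +%R.
Proof. by move=> a f g; apply: funext => n; apply: mulrDr. Qed.
Fact ps_scaleDl f : {morph ps_scale^~ f : a b / a + b}.
Proof. by move=> a b; apply: funext => n; apply: mulrDl. Qed.

HB.instance Definition _ := GRing.Zmodule_isLmodule.Build A (pseries A)
  ps_scaleA ps_scale1 ps_scaleDr ps_scaleDl.

Fact ps_scaleAl (a : A) (f g : pseries A) : a *: (f * g) = (a *: f) * g.
Proof.
apply: funext => n; rewrite [LHS]mulr_sumr.
by apply: eq_bigr => j _; rewrite mulrA.
Qed.

HB.instance Definition _ := GRing.Lmodule_isLalgebra.Build A (pseries A) ps_scaleAl.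

Definition psX : pseries A := fun n => (n == 1%N)%:R.

(** The z-adic valuation, with [None] for the infinite valuation of 0. *)
Definition ps_val f : option nat :=
  if pselect (exists n, f n != 0) is left nz_f then Some (ex_minn nz_f) else None.

Lemma ps_valP f n :
  ps_val f = Some n <-> f n != 0 /\ (forall i, (i < n)%N -> f i = 0).
Proof.
rewrite /ps_val; case: pselect => [nz_f|z_f]; last first.
  by split=> // -[nz_fn _]; case: z_f; exists n.
case: ex_minnP => m nz_fm min_m; split=> [[<-]|[nz_fn z_f]].
  split=> // i lt_im; apply/eqP; apply: contraLR lt_im => /min_m.
  by rewrite -leqNgt.
congr Some; apply/eqP; rewrite eqn_leq min_m //= leqNgt.
by apply: contraNN nz_fm => /z_f ->.
Qed.

End PowerSeriesRing.

Definition ps_map (A B : Type) (phi : A -> B) (f : pseries A) : pseries B :=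
  phi \o f.

(** A group of [A]-automorphisms of A[[z]] isomorphic to [G], given as a
    faithful action of [G]; each [aut g] is bijective, with inverse
    [aut (g^-1)]. *)
Record ps_aut_group (G : finGroupType) (A : comNzRingType) := PsAutGroup {
  aut :> G -> {lrmorphism pseries A -> pseries A};
  aut1 : forall f, aut 1%g f = f;
  autM : forall g h f, aut (g * h)%g f = aut g (aut h f);
  aut_faithful : forall g, (forall f, aut g f = f) -> g = 1%g
}.

Definition is_ideal (A : comNzRingType) (I : A -> Prop) :=
  [/\ I 0, (forall x y, I x -> I y -> I (x + y)) & (forall a x, I x -> I (a * x))].

Definition is_principal (A : comNzRingType) (I : A -> Prop) :=
  exists a, forall x, I x <-> exists b, x = b * a.

(** In a local ring, the non-units form the maximal ideal. *)
Definition nonunit (A : comNzRingType) (x : A) := ~ exists y, x * y = 1.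

Definition is_local (A : comNzRingType) :=
  forall x y : A, nonunit x -> nonunit y -> nonunit (x + y).

(** A discrete valuation ring is a local principal ideal domain that is not a
    field. *)
Definition is_dvr (R : idomainType) :=
  [/\ forall I : R -> Prop, is_ideal I -> is_principal I,
      is_local R
    & exists2 x : R, x != 0 & nonunit x].

(** The local ring [B] dominates the local ring [A] through [iota]: [iota]
    identifies [A] with a subring of [B] and [m_B] meets [A] in [m_A]. *)
Definition dominates (A B : comNzRingType) (iota : {rmorphism A -> B}) :=
  injective iota /\ forall x, nonunit (iota x) <-> nonunit x.

(** [(kappa, res)] is the residue field of the local ring [R]: the kernel of a
    surjection of [R] onto a field is the maximal ideal. *)
Definition is_residue_field (R : comNzRingType) (kappa : fieldType)
    (res : {rmorphism R -> kappa}) :=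
  forall c, exists x, res x = c.

(** The action [Sigma] on R[[Z]] reduces to the action [sigma] on k[[z]]; here
    [res : R -> kappa] is the residue map and [j : k -> kappa] the inclusion of
    [k] in the residue field ([j] is the identity when [kappa] is [k]). *)
Definition reduces_to (G : finGroupType) (k R kappa : comNzRingType)
    (res : {rmorphism R -> kappa}) (j : {rmorphism k -> kappa})
    (Sigma : ps_aut_group G R) (sigma : ps_aut_group G k) :=
  forall g (F : pseries R) (f : pseries k),
    ps_map res F = ps_map j f -> ps_map res (Sigma g F) = ps_map j (sigma g f).

(* Main.v *)
Require Import Defs.
From HB Require Import structures.
From mathcomp Require Import all_boot all_order all_algebra all_fingroup.
From mathcomp Require Import boolp classical_sets generic_quotient ring_quotient.
From mathcomp Require Import zify ring.

(** Let [a g] be the residue of the coefficient of [Z ^ p] in [g Z - Z]; it is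
    additive in [g], and nonzero for [g <> 1]. If the action lifts, take [s] and
    [t] generating [G], a fixed point [y] of [s] and a fixed point [w] of [t] over
    some extension of [R]. They have no common fixed point, so the fixed points of
    [s] are the [t ^ l y], those of [t] are the [s ^ l w], and up to factors
    congruent to 1 modulo the maximal ideal
      [t y - y = a t * (y - w) ^ p] and [s w - w = a s * (w - y) ^ p].
    The derivatives at [y] and [w] of the series [s Z] and [t Z] are nontrivial
    p-th roots of unity, and (again up to such factors)
      [s'(y) - 1 = - a s * (t y - y) ^ (p - 1)] and
      [t'(w) - 1 = - a t * (s w - w) ^ (p - 1)].
    Since [(zeta ^ h - 1) / (zeta - 1)] is congruent to [h], the quotient
    [(a t / a s) ^ (p - 2)] lies in the prime field; so [(a g) ^ (p - 1)] takes at
    most [p - 2] values, up to a common factor, while it separates the [p + 1]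
    lines of [G]. *)

Set Implicit Arguments.
Unset Strict Implicit.
Unset Printing Implicit Defensive.

Import GRing.Theory.

Local Open Scope ring_scope.
Local Open Scope quotient_scope.

(** * Prime ideals avoiding the powers of an element *)

Section PrimeQuotient.
Variables (A : comNzRingType) (P : A -> Prop).
Hypotheses (P_ideal : is_ideal P) (P_proper : ~ P 1).
Hypothesis P_prime : forall x y, P (x * y) -> P x \/ P y.

Definition prime_pred : {pred A} := fun x => `[< P x >].

Fact prime_pred_idealr : idealr_closed prime_pred.
Proof.
case: P_ideal => P0 PD PM; split=> [||a u v].
- exact/asboolP.
- exact/asboolP.
- by move=> /asboolP Pu /asboolP Pv; apply/asboolP/PD => //; apply: PM.
Qed.

HB.instance Definition _ := isIdealr.Build A prime_pred prime_pred_idealr.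

Fact prime_pred_prime : prime_idealr_closed prime_pred.
Proof.
by move=> u v /asboolP/P_prime[/asboolP|/asboolP] uv; apply/orP; [left|right].
Qed.

HB.instance Definition _ := isPrimeIdealrClosed.Build A prime_pred prime_pred_prime.

Definition prime_quot := {ideal_quot prime_pred}.
HB.instance Definition _ := GRing.ComNzRing.on prime_quot.

(** An integral domain comes with an inverse function, so units are decided classically and a chosen
    inverse is extended by the identity. *)
Definition pq_unit : {pred prime_quot} := fun x => `[< exists y, y * x = 1 >].
Definition pq_inv (x : prime_quot) : prime_quot :=
  if pselect (exists y, y * x = 1) is left ex then projT1 (cid ex) else x.

Fact pq_mulVx : {in pq_unit, left_inverse 1 pq_inv *%R}.
Proof.
move=> x /asboolP ex; rewrite /pq_inv; case: pselect => // ex'.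
by case: (cid ex').
Qed.
Fact pq_unitP x y : y * x = 1 -> pq_unit x.
Proof. by move=> yx; apply/asboolP; exists y. Qed.
Fact pq_invr_out : {in [predC pq_unit], pq_inv =1 id}.
Proof.
move=> x /= /asboolP nex; rewrite /pq_inv; by case: pselect.
Qed.

HB.instance Definition _ := GRing.ComNzRing_hasMulInverse.Build prime_quot
  pq_mulVx pq_unitP pq_invr_out.
Fact pq_integral (x y : prime_quot) : x * y = 0 -> (x == 0) || (y == 0).
Proof. exact: (@Quotient.rquot_IdomainAxiom _ prime_pred). Qed.
HB.instance Definition _ := GRing.ComUnitRing_isIntegral.Build prime_quot
  pq_integral.

Lemma prime_quotient : exists (D : idomainType) (q : {rmorphism A -> D}),
  (forall d, exists a, q a = d) /\ (forall a, q a = 0 <-> P a).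
Proof.
pose q : {rmorphism A -> prime_quot} := \pi_prime_quot.
exists prime_quot, q; split=> [d|a]; first by exists (repr d); rewrite /q /= reprK.
have qE : (q a == 0) = `[< P a >].
  by rewrite -(rmorph0 q) -Quotient.idealrBE subr0.
by rewrite -(asboolE (P a)) -qE; split=> /eqP.
Qed.

End PrimeQuotient.

(** Zorn's lemma on the ideals that contain [I0] and avoid the powers of [w]. The last clause is
    maximality, applied to the ideal generated by [P] and [x]. *)
Lemma maximal_ideal_avoiding (A : comNzRingType) (w : A) (I0 : A -> Prop) :
    is_ideal I0 -> (forall n, ~ I0 (w ^+ n)) ->
  exists P : A -> Prop, [/\ is_ideal P, forall x, I0 x -> P x,
    forall n, ~ P (w ^+ n)
    & forall x, ~ P x -> exists n a b, P b /\ w ^+ n = b + a * x].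
Proof.
move=> I0_ideal I0w.
pose good I := [/\ is_ideal I, forall x, I0 x -> I x & forall n, ~ I (w ^+ n)].
pose T := {I : A -> Prop | good I}.
pose le (s t : T) := forall x, sval s x -> sval t x.
have [||||[P [P_ideal I0P Pw]] maxP] := Zorn (R := fun s t : T => `[< le s t >]).
- by move=> t; apply/asboolP.
- by move=> s t u /asboolP st /asboolP tu; apply/asboolP => x /st /tu.
- move=> [s gs] [t gt] /asboolP st /asboolP ts; apply: eq_exist => /=.
  by apply: funext => x; apply: propext; split; [exact: st|exact: ts].
(* The empty chain is bounded by [I0] itself, a nonempty one by its union. *)
- move=> C Ctot; have [[c0 Cc0]|C0] := pselect (exists c, C c); last first.
    have gI0 : good I0 by split.
    by exists (exist _ I0 gI0) => s Cs; case: C0; exists s.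
  have {}Ctot c d : C c -> C d -> le c d \/ le d c.
    by move=> Cc Cd; case: (Ctot c d Cc Cd) => /asboolP; [left|right].
  pose U x := exists2 c : T, C c & sval c x.
  have gU : good U.
    split.
    - split.
      + by exists c0 => //; case: (svalP c0) => -[].
      + move=> x y [c Cc cx] [d Cd dy].
        have [cd|dc] := Ctot c d Cc Cd.
          by exists d => //; case: (svalP d) => -[_ + _] _ _; apply=> //; apply: cd.
        by exists c => //; case: (svalP c) => -[_ + _] _ _; apply=> //; apply: dc.
      + by move=> a x [c Cc cx]; exists c => //; case: (svalP c) => -[_ _ +] _ _; apply.
    - by move=> x I0x; exists c0 => //; case: (svalP c0) => _ + _; apply.
    - by move=> n [c Cc]; case: (svalP c) => _ _; apply.
  by exists (exist _ U gU) => s Cs; apply/asboolP => x sx; exists s.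
exists P; split=> // x Px.
have [P0 PD PM] := P_ideal.
apply: contrapT => nex; apply: Px.
pose Q y := exists a b, P b /\ y = b + a * x.
have gQ : good Q.
  split.
  - split.
    + by exists 0, 0; rewrite mul0r addr0.
    + move=> _ _ [a [b [Pb ->]]] [c [d [Pd ->]]].
      by exists (a + c), (b + d); rewrite mulrDl addrACA; split=> //; apply: PD.
    + move=> c _ [a [b [Pb ->]]].
      by exists (c * a), (c * b); rewrite mulrDr mulrA; split=> //; apply: PM.
  - by move=> y /I0P Py; exists 0, y; rewrite mul0r addr0.
  - by move=> n [a [b Pb]]; apply: nex; exists n, a, b.
have /= := maxP (exist _ Q gQ).
have PQ : le (exist _ P (And3 P_ideal I0P Pw)) (exist _ Q gQ).
  by move=> y /= Py; exists 0, y; rewrite mul0r addr0.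
move=> /(_ (asboolT PQ)) /(congr1 sval) /= <-.
by exists 1, 0; rewrite mul1r add0r.
Qed.

(** [D] is the quotient by a maximal such [P]. If [x] and [y] lie outside [P], they divide powers of
    [w] modulo [P]; so [x * y] in [P] would put a power of [w] in [P]. The last clause says that
    inverting [w] turns [D] into a field. *)
Lemma prime_avoiding (A : comNzRingType) (w : A) (I0 : A -> Prop) :
    is_ideal I0 -> (forall n, ~ I0 (w ^+ n)) ->
  exists (D : idomainType) (q : {rmorphism A -> D}),
    [/\ forall d, exists a, q a = d, forall x, I0 x -> q x = 0, q w != 0
      & forall d, d != 0 -> exists n d', q w ^+ n = d' * d].
Proof.
move=> I0_ideal I0w.
have [P [P_ideal I0P Pw Pmax]] := maximal_ideal_avoiding I0_ideal I0w.
have [P0 PD PM] := P_ideal.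
have P1 : ~ P 1 by move: (Pw 0%N); rewrite expr0.
have Pprime x y : P (x * y) -> P x \/ P y.
  move=> Pxy; apply: contrapT => /not_orP[/Pmax[n [a [b [Pb En]]]] /Pmax[m [c [d [Pd Em]]]]].
  apply: (Pw (n + m)%N); rewrite exprD En Em mulrDl.
  apply: (PD); first by rewrite mulrC; apply: PM.
  rewrite mulrDr; apply: PD; first exact: PM.
  by rewrite mulrACA; apply: PM.
have [D [q [q_surj q0]]] := prime_quotient P_ideal P1 Pprime.
exists D, q; split=> //.
- by move=> x /I0P /q0.
- by apply/eqP => /q0; have := Pw 1%N; rewrite expr1.
move=> d d0; have [x Ex] := q_surj d.
have nPx : ~ P x by move=> /q0 Ex0; move: d0; rewrite -Ex Ex0 eqxx.
have [n [a [b [/q0 Pb En]]]] := Pmax x nPx.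
by exists n, (q a); rewrite -rmorphXn En rmorphD rmorphM Pb add0r Ex.
Qed.

(** * Power series *)

Section PowerSeriesTheory.
Variable A : comNzRingType.
Implicit Types (f g h : pseries A) (c : A).

Definition ps_shift f : pseries A := fun n => f n.+1.

Lemma psP f g : f =1 g -> f = g.
Proof. exact: funext. Qed.

Definition psC : {rmorphism A -> pseries A} := in_alg (pseries A).

Lemma coefpsC c n : psC c n = if n is 0%N then c else 0.
Proof. by case: n => [|n]; [exact: mulr1|exact: mulr0]. Qed.

Lemma coefpsCM c f n : (psC c * f) n = c * f n.
Proof. exact: (congr1 (fun h : pseries A => h n) (mulr_algl c f)). Qed.

Lemma coefpsXM f n : (psX A * f) n = if n is m.+1 then f m else 0.
Proof.
case: n => [|n]; first by rewrite [LHS]big_ord1 mul0r.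
rewrite [LHS]big_ord_recl mul0r add0r big_ord_recl big1 => [|i _].
  by rewrite addr0 mul1r subn1.
by rewrite mul0r.
Qed.

Lemma ps_decomp f : f = psC (f 0%N) + psX A * ps_shift f.
Proof.
apply: psP => n; rewrite [RHS](_ : _ = psC (f 0%N) n + (psX A * ps_shift f) n) //.
by rewrite coefpsC coefpsXM; case: n => [|n]; rewrite ?addr0 ?add0r.
Qed.

Definition ps_const f : A := f 0%N.
Fact ps_const_additive : zmod_morphism ps_const.
Proof. by []. Qed.
Fact ps_const_multiplicative : monoid_morphism ps_const.
Proof. by split=> // f g; rewrite [LHS]big_ord1. Qed.
HB.instance Definition _ :=
  GRing.isZmodMorphism.Build (pseries A) A ps_const ps_const_additive.
HB.instance Definition _ :=
  GRing.isMonoidMorphism.Build (pseries A) A ps_const ps_const_multiplicative.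

Lemma ps_const0M f g : (f * g) 0%N = f 0%N * g 0%N.
Proof. exact: (rmorphM ps_const). Qed.

(** The first [n] coefficients of the inverse of [f], kept in a list since each one depends on all
    earlier ones; [u] stands for the inverse of [f 0]. *)
Fixpoint ps_inv_seq (u : A) f n : seq A :=
  if n is m.+1 then
    let s := ps_inv_seq u f m in
    rcons s (u * ((m == 0%N)%:R - \sum_(i < m) s`_i * f (m - i)%N))
  else [::].

Lemma size_ps_inv_seq u f n : size (ps_inv_seq u f n) = n.
Proof. by elim: n => //= n IHn; rewrite size_rcons IHn. Qed.

Lemma nth_ps_inv_seq u f n i : (i < n)%N ->
  (ps_inv_seq u f n)`_i = (ps_inv_seq u f i.+1)`_i.
Proof.
elim: n => // n IHn; rewrite ltnS leq_eqVlt => /predU1P[->//|lt_in].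
by rewrite /= nth_rcons size_ps_inv_seq lt_in IHn.
Qed.

Lemma ps_unit f u : f 0%N * u = 1 -> exists g, f * g = 1.
Proof.
move=> fu; pose g : pseries A := fun n => (ps_inv_seq u f n.+1)`_n.
exists g; rewrite mulrC; apply: psP => n; rewrite [LHS]big_ord_recr /= subnn.
have -> : g n = u * ((n == 0%N)%:R - \sum_(i < n) g i * f (n - i)%N).
  rewrite {1}/g /= nth_rcons size_ps_inv_seq ltnn eqxx.
  by congr (_ * (_ - _)); apply: eq_bigr => i _; rewrite nth_ps_inv_seq.
by rewrite mulrAC [u * _]mulrC fu mul1r addrC subrK.
Qed.

End PowerSeriesTheory.

Section MapPowerSeries.
Variables (A B : comNzRingType) (phi : {rmorphism A -> B}).

Fact ps_map_additive : zmod_morphism (ps_map phi).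
Proof. by move=> f g; apply: psP => n; exact: rmorphB. Qed.
Fact ps_map_multiplicative : monoid_morphism (ps_map phi).
Proof.
split=> [|f g]; apply: psP => n; first exact: rmorph_nat.
rewrite [LHS](rmorph_sum phi); apply: eq_bigr => i _; exact: rmorphM.
Qed.
HB.instance Definition _ :=
  GRing.isZmodMorphism.Build (pseries A) (pseries B) (ps_map phi) ps_map_additive.
HB.instance Definition _ :=
  GRing.isMonoidMorphism.Build (pseries A) (pseries B) (ps_map phi)
    ps_map_multiplicative.

Lemma ps_mapC c : ps_map phi (psC A c) = psC B (phi c).
Proof. by apply: psP => -[|n]; rewrite [LHS]/comp !coefpsC ?rmorph0. Qed.

Lemma ps_mapX : ps_map phi (psX A) = psX B.
Proof. by apply: psP => n; exact: rmorph_nat. Qed.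

End MapPowerSeries.

Section FactorMorphism.
Variables (A B C : comNzRingType) (q : {rmorphism A -> B}) (h : {rmorphism A -> C}).
Hypotheses (q_surj : forall b, exists a, q a = b) (qh : forall a, q a = 0 -> h a = 0).

Definition factor_fun b : C := h (projT1 (cid (q_surj b))).

Lemma factor_funE a : factor_fun (q a) = h a.
Proof.
rewrite /factor_fun; case: cid => a' /= Ea; apply/eqP; rewrite -subr_eq0 -rmorphB.
by apply/eqP/qh; rewrite rmorphB Ea subrr.
Qed.

Fact factor_fun_additive : zmod_morphism factor_fun.
Proof.
move=> b c; have [a <-] := q_surj b; have [d <-] := q_surj c.
by rewrite -rmorphB !factor_funE rmorphB.
Qed.
Fact factor_fun_multiplicative : monoid_morphism factor_fun.
Proof.
split=> [|b c]; first by rewrite -(rmorph1 q) factor_funE rmorph1.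
have [a <-] := q_surj b; have [d <-] := q_surj c.
by rewrite -rmorphM !factor_funE rmorphM.
Qed.
HB.instance Definition _ := GRing.isZmodMorphism.Build B C factor_fun factor_fun_additive.
HB.instance Definition _ :=
  GRing.isMonoidMorphism.Build B C factor_fun factor_fun_multiplicative.

Lemma rmorph_factor : exists h' : {rmorphism B -> C}, forall a, h' (q a) = h a.
Proof. by exists factor_fun; exact: factor_funE. Qed.

End FactorMorphism.

(** * Nilpotency modulo an element, and splitting off the low terms of a series *)

Section Radical.
Variables (A : comNzRingType) (w : A).

(** The radical of the principal ideal generated by [w]. *)
Definition in_rad (x : A) := exists n y, x ^+ n = y * w.

Lemma in_radM a x : in_rad x -> in_rad (a * x).
Proof. by case=> n [y E]; exists n, (a ^+ n * y); rewrite exprMn E mulrA. Qed.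

(** Each term of the binomial expansion of [(x + y) ^+ (n + m)] contains [x ^+ n] or [y ^+ m]. *)
Lemma in_radD x y : in_rad x -> in_rad y -> in_rad (x + y).
Proof.
move=> [n [a Ex]] [m [b Ey]]; exists (n + m)%N.
rewrite exprDn; elim/big_rec: _ => [|i _ _ [c ->]]; first by exists 0; rewrite mul0r.
suff [d ->] : exists d, x ^+ (n + m - i) * y ^+ i = d * w.
  by exists (d *+ 'C(n + m, i) + c); rewrite mulrDl mulrnAl.
have [le_mi|/ltnW le_im] := leqP m i.
  exists (x ^+ (n + m - i) * (y ^+ (i - m) * b)).
  by rewrite -{2}(subnK le_mi) exprD Ey !mulrA.
exists (a * x ^+ (m - i) * y ^+ i).
by rewrite -addnBA // exprD Ex (mulrAC a) (mulrAC _ w).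
Qed.

Lemma in_rad_exp x n : in_rad (x ^+ n) -> in_rad x.
Proof. by case=> m [y E]; exists (n * m)%N, y; rewrite exprM. Qed.

End Radical.

Lemma in_rad_rmorph (A B : comNzRingType) (phi : {rmorphism A -> B}) w x :
  in_rad w x -> in_rad (phi w) (phi x).
Proof. by case=> n [y E]; exists n, (phi y); rewrite -rmorphXn E rmorphM. Qed.

Lemma dvd_const_shift (A : comNzRingType) (w : A) n (f g : pseries A) :
  psX A ^+ n * f = g * psC A w -> exists h, f = h * psC A w.
Proof.
elim: n f => [|n IHn] f; first by rewrite mul1r; exists g.
rewrite exprSr -mulrA => /IHn[h Eh]; exists (ps_shift h).
apply: psP => i; move: (congr1 (fun u : pseries A => u i.+1) Eh).
by rewrite coefpsXM mulrC coefpsCM => ->; rewrite [in RHS]mulrC coefpsCM.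
Qed.

(** A weak form of Weierstrass preparation: [N] collects the terms of degree less than [p], finitely
    many elements of the radical. *)
Lemma weierstrass_split (A : comNzRingType) (w : A) p (G : pseries A) :
    (forall i, (i < p)%N -> in_rad w (G i)) ->
  exists N U : pseries A,
    [/\ G = N + psX A ^+ p * U, in_rad (psC A w) N & U 0%N = G p].
Proof.
elim: p G => [|p IHp] G radG.
  exists 0, G; rewrite add0r mul1r; split=> //.
  by exists 1%N, 0; rewrite mul0r.
have [i lt_ip|N [U [EG radN EU]]] := IHp (ps_shift G); first exact: (radG i.+1).
exists (psC A (G 0%N) + psX A * N), U; split=> //.
  by rewrite -addrA exprS -mulrA -mulrDr -EG -ps_decomp.
apply: in_radD; last exact: in_radM.
exact: (in_rad_rmorph (psC A) (radG 0%N isT)).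
Qed.

(** * Adjoining a zero of a power series to the base ring *)

(** A substitute for complete valuation rings: as every element of the maximal
    ideal [ker rho] is nilpotent modulo [w], and every nonzero element divides a
    power of [w], large powers of a fixed element of [ker rho] are divisible by
    any given nonzero element. Power series can then be evaluated up to
    arbitrarily small errors without any completeness. *)
Definition tame (K : fieldType) (D : idomainType) (rho : {rmorphism D -> K})
    (w : D) :=
  [/\ w != 0 /\ rho w = 0, forall x, rho x != 0 -> exists y, x * y = 1,
      forall x, x != 0 -> exists n y, w ^+ n = y * x
    & forall x, rho x = 0 -> in_rad w x].

Section Extension.
Variables (K : fieldType) (D : idomainType) (rho : {rmorphism D -> K}) (w : D).
Hypothesis D_tame : tame rho w.
Variables (p : nat) (G : pseries D).
Hypotheses (p_gt0 : (0 < p)%N) (G_low : forall i, (i < p)%N -> rho (G i) = 0).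
Hypothesis G_unit : rho (G p) != 0.

(** Modulo [w], [G] is the sum of a nilpotent series and of a regular one, so it
    is not a zero divisor and [w] can be cancelled from [w ^ n.+1 = B * G]. *)
Lemma constant_not_multiple n B : B * G <> psC D (w ^+ n).
Proof.
have [[w0 rw0] unitD _ radD] := D_tame.
elim: n B => [|n IHn] B EB.
  move/(congr1 (fun f : pseries D => rho (f 0%N)))/eqP: EB.
  by rewrite ps_const0M rmorphM G_low // mulr0 coefpsC rmorph1 eq_sym oner_eq0.
have [i /G_low/radD //|N [U [EG [c [y radN]] EU]]] := @weierstrass_split _ w p G.
have [u Uu] : exists u, U 0%N * u = 1 by rewrite EU; exact: unitD.
have [V UV] := ps_unit Uu.
(* Modulo [w], [B * G] vanishes, so multiplying [B] by [Z ^ p * U] amounts to multiplying it by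
   [- N]. For [k = c] the power of [N] disappears too; as [U] is invertible, [w] divides [B]. *)
have pow k : exists q, (psX D ^+ p * U) ^+ k * B = (- N) ^+ k * B + q * psC D w.
  elim: k => [|k [q Eq]]; first by exists 0; rewrite mul0r addr0 !mul1r.
  exists ((psX D ^+ p * U) * q + (- N) ^+ k * psC D (w ^+ n)).
  have EXB : (psX D ^+ p * U) * B = - N * B + psC D (w ^+ n) * psC D w.
    rewrite -(rmorphM (psC D)) -exprSr -EB EG mulrDr addrA.
    by rewrite mulNr mulrC [B * N]mulrC addNr add0r.
  rewrite exprS -mulrA Eq mulrDr mulrCA EXB mulrDr mulrDl !mulrA -addrA.
  by rewrite -exprSr [X in _ + X = _]addrC.
have [q Eq] := pow c.
have [h Eh] : exists h, B = h * psC D w.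
  have Ec : (psX D ^+ (p * c)) * (U ^+ c * B) =
      ((- 1) ^+ c * y * B + q) * psC D w.
    rewrite mulrA exprM -exprMn Eq (exprNn N) radN mulrDl; congr (_ + _).
    by rewrite -!mulrA [B * _]mulrC !mulrA.
  have [h Eh] := dvd_const_shift Ec.
  exists (V ^+ c * h); rewrite -mulrA -Eh mulrA -exprMn.
  by rewrite [V * U]mulrC UV expr1n mul1r.
apply: (IHn h); apply: psP => i.
move/(congr1 (fun f : pseries D => f i)): EB.
rewrite Eh mulrAC mulrC coefpsCM exprS.
rewrite (rmorphM (psC D)) coefpsCM; exact: mulfI.
Qed.

(** [D'] is the quotient of D[[Z]] by an ideal that is maximal among those that
    contain [G] and no power of [w]; such an ideal is prime. *)
Lemma tame_extension : exists (D' : idomainType) (rho' : {rmorphism D' -> K})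
    (e : {rmorphism pseries D -> D'}),
  [/\ tame rho' (e (psC D w)), e G = 0 & forall f, rho' (e f) = rho (f 0%N)].
Proof.
have [[w0 rw0] unitD divD radD] := D_tame.
pose I0 x := exists B, x = B * G.
have I0_ideal : is_ideal I0.
  split; first by exists 0; rewrite mul0r.
    by move=> _ _ [B ->] [C ->]; exists (B + C); rewrite mulrDl.
  by move=> a _ [B ->]; exists (a * B); rewrite mulrA.
have I0w n : ~ I0 ((psC D w) ^+ n).
  rewrite -(rmorphXn (psC D)) => -[B] /esym.
  exact: constant_not_multiple.
have [D' [e [e_surj e0 ew0 divD']]] := prime_avoiding I0_ideal I0w.
have unitE f : rho (f 0%N) != 0 -> exists y, e f * y = 1.
  move=> /unitD[u fu]; have [g fg] := ps_unit fu.
  by exists (e g); rewrite -rmorphM fg rmorph1.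
(* A series killed by [e] has its constant term in the kernel of [rho], since otherwise its image
   would be a unit. *)
have [rho' Erho'] : exists rho' : {rmorphism D' -> K},
    forall f, rho' (e f) = (rho \o @ps_const D) f.
  apply: rmorph_factor => // f ef; apply/eqP/negP => /negP/unitE[y /eqP].
  by rewrite ef mul0r eq_sym oner_eq0.
have eG : e G = 0 by apply: e0; exists 1; rewrite mul1r.
exists D', rho', e; split=> //; split=> //.
  by split=> //; rewrite Erho' -rw0; congr (rho _); exact: coefpsC.
  by move=> d; have [f <-] := e_surj d; rewrite Erho'; exact: unitE.
move=> d; have [f <-] := e_surj d; rewrite Erho' => rf.
rewrite (ps_decomp f) rmorphD rmorphM; apply: in_radD.
  exact: (in_rad_rmorph (e \o psC D) (radD _ rf)).
rewrite mulrC; apply: in_radM.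
(* The variable becomes nilpotent modulo [w]: since [e G = 0] and [e U] is a unit, its [p]-th power
   is a multiple of [e N]. *)
have [i /G_low/radD //|N [U [EG radN EU]]] := @weierstrass_split _ w p G.
have [u eUu] : exists u, e U * u = 1 by apply: unitE; rewrite EU.
apply: (@in_rad_exp _ _ _ p).
have -> : e (psX D) ^+ p = - u * e N.
  have: (e N + e (psX D) ^+ p * e U) * u = 0.
    by rewrite -rmorphXn -rmorphM -rmorphD -EG eG mul0r.
  by rewrite mulrDl -mulrA eUu mulr1 => /eqP; rewrite addrC addr_eq0 mulNr mulrC => /eqP.
by apply: in_radM; exact: in_rad_rmorph.
Qed.

End Extension.

(** * Taylor expansion, and interpolation with denominators *)

Section Taylor.
Variable A : comNzRingType.
Implicit Types f g : pseries A.

(** [taylor f] is [f (Z + T)], as a power series in [T] over A[[Z]]. *)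
Definition taylor f : pseries (pseries A) :=
  fun n m => f (n + m)%N *+ 'C(n + m, n).

Fact taylor_additive : zmod_morphism taylor.
Proof. by move=> f g; do 2!apply: psP => ?; exact: mulrnBl. Qed.

Lemma ps_sum_coef (I : Type) (r : seq I) (F : I -> pseries A) n :
  (\sum_(i <- r) F i) n = \sum_(i <- r) F i n.
Proof. exact: (big_morph (fun f : pseries A => f n)). Qed.

(** Vandermonde's identity splits the binomial coefficient in each term of the convolution; for
    fixed [i] the terms with [s] outside the interval from [i] to [i + m] vanish. *)
Fact taylor_multiplicative : monoid_morphism taylor.
Proof.
split.
  apply: psP => n; apply: psP => m.
  have -> : taylor 1 n m = (n + m == 0)%N%:R *+ 'C(n + m, n) by [].
  have -> : (1 : pseries (pseries A)) n m = ((n == 0)%N && (m == 0)%N)%:R.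
    by case: n m => [|n] [|m].
  by rewrite addn_eq0; case: n m => [|n] [|m] //=; rewrite mul0rn.
move=> f g; apply: psP => n; apply: psP => m.
pose F s i := (f s * g (n + m - s)%N) *+ ('C(s, i) * 'C(n + m - s, n - i)).
have -> : taylor (f * g) n m = \sum_(i < n.+1) \sum_(0 <= s < (n + m).+1) F s i.
  rewrite exchange_big /= big_mkord /taylor -sumrMnl; apply: eq_bigr => s _.
  have le_s : (s <= n + m)%N by rewrite -ltnS.
  rewrite -[X in 'C(X, n)](subnKC le_s) -binomial.Vandermonde.
  by rewrite -sumrMnr; apply: eq_bigr => i _; rewrite /F.
rewrite [RHS](ps_sum_coef _ _ m); apply: eq_bigr => i _.
have le_i : (i <= n)%N by rewrite -ltnS.
rewrite [RHS]/GRing.mul /= /ps_mul.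
rewrite (@big_cat_nat _ _ _ i) //=; last by rewrite (leq_trans le_i) // ltnW // ltnS leq_addr.
rewrite [X in X + _]big_nat_cond [X in X + _]big1 ?add0r; last first.
  by move=> s /andP[/andP[_ lt_si] _]; rewrite /F bin_small // mulr0n.
rewrite (@big_cat_nat _ _ _ (i + m).+1) //=; first last.
- by rewrite ltnS leq_add2r.
- by rewrite ltnW // ltnS leq_addr.
rewrite [X in _ + X]big_nat_cond [X in _ + X]big1 ?addr0; last first.
  move=> s /andP[/andP[lt_is lt_s] _]; rewrite /F [X in (_ * X)%N]bin_small ?muln0 ?mulr0n //.
  by lia.
rewrite -[X in index_iota X](add0n i) big_addn subSn ?leq_addr // addKn big_mkord /taylor.
apply: eq_bigr => j _; have le_j : (j <= m)%N by rewrite -ltnS.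
rewrite /F addnC mulrnAl mulrnAr -mulrnA.
have -> : (n + m - (i + j) = n - i + (m - j))%N by lia.
by rewrite mulnC.
Qed.

HB.instance Definition _ := GRing.isZmodMorphism.Build (pseries A)
  (pseries (pseries A)) taylor taylor_additive.
HB.instance Definition _ := GRing.isMonoidMorphism.Build (pseries A)
  (pseries (pseries A)) taylor taylor_multiplicative.

Lemma taylorC c : taylor (psC A c) = psC (pseries A) (psC A c).
Proof.
apply: psP => n; apply: psP => m; rewrite coefpsC /taylor.
rewrite coefpsC; case: n => [|n]; last by rewrite addSn mul0rn.
by rewrite add0n bin0 coefpsC.
Qed.

Lemma taylorX : taylor (psX A) = psC (pseries A) (psX A) + psX (pseries A).
Proof.
apply: psP => n; apply: psP => m.
rewrite [RHS](_ : _ = psC (pseries A) (psX A) n m + psX (pseries A) n m) //.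
rewrite coefpsC /taylor /psX.
case: n => [|[|n]].
- by rewrite add0n bin0 [RHS]addr0.
- case: m => [|m]; first by rewrite [RHS]add0r.
  by rewrite mul0rn [RHS]add0r.
- by rewrite mul0rn [RHS]add0r.
Qed.

End Taylor.

(** [E] depends only on the nodes and on [d]. By induction, [f - f.[y]] is divided by ['X - y%:P]:
    the factor [V] of the new [E] pays for the denominators [z - y] in the values of the quotient,
    and the factor [d] sends [f.[y]] into the remainder. *)
Lemma poly_interpolation (D : idomainType) (ys : seq D) (d : D) :
    uniq ys -> d != 0 ->
  exists2 E, E != 0 & forall f : {poly D},
    (forall y, y \in ys -> exists c, f.[y] = c * E) ->
    exists q r : {poly D}, f = q * \prod_(y <- ys) ('X - y%:P) + d *: r.
Proof.
elim: ys => [|y ys IHys] /= => [_ d0|/andP[y_ys uniq_ys] d0].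
  exists 1; rewrite ?oner_eq0 // => f _; exists f, 0.
  by rewrite big_nil mulr1 scaler0 addr0.
have [E E0 IHE] := IHys uniq_ys d0.
pose V := \prod_(z <- ys) (z - y).
have V0 : V != 0.
  rewrite /V prodf_seq_neq0; apply/allP => z zys /=; rewrite subr_eq0.
  by apply: contraNneq y_ys => <-.
exists (E * V * d) => [|f fE]; first by rewrite !mulf_neq0.
have [c0 Ec0] := fE y (mem_head _ _).
have /factor_theorem[g Eg] : root (f - (f.[y])%:P) y.
  by rewrite /root hornerD hornerN hornerC subrr.
have [z zys|q [r Er]] := IHE g.
  have [c Ec] : exists c, f.[z] = c * (E * V * d).
    by apply: fE; rewrite inE zys orbT.
  have zy0 : z - y != 0.
    by rewrite subr_eq0; apply: contraNneq y_ys => <-.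
  pose V' := \prod_(t <- rem z ys) (t - y).
  have EV : V = (z - y) * V' by rewrite /V (big_rem _ zys).
  exists ((c - c0) * V' * d); apply: (mulIf zy0).
  have := congr1 (horner^~ z) Eg; rewrite hornerM hornerXsubC => <-.
  by rewrite hornerD hornerN hornerC Ec Ec0 -mulrBl EV; ring.
exists q, (r * ('X - y%:P) + (c0 * (E * V))%:P).
rewrite big_cons -[LHS](subrK (f.[y])%:P) Eg Er Ec0 scalerDr -mul_polyC polyCM.
by rewrite -!mul_polyC !polyCM; ring.
Qed.

(** * Points of the open disc *)

Lemma coef1psM (A : comNzRingType) (f g : pseries A) :
  (f * g) 1%N = f 0%N * g 1%N + f 1%N * g 0%N.
Proof. by rewrite [LHS]big_ord_recl big_ord1. Qed.

Lemma coefpsM_high (A : comNzRingType) (u v : pseries A) n :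
  (forall l, (l < n)%N -> v l = 0) -> (u * v) n = u 0%N * v n.
Proof.
move=> v0; rewrite [LHS]big_ord_recl big1 ?addr0 => [|l _]; first by rewrite subn0.
by rewrite v0 ?mulr0 // lift0 ltn_subrL (leq_ltn_trans _ (ltn_ord l)).
Qed.

Section Points.
Variables (R : comNzRingType) (K : fieldType) (res : {rmorphism R -> K}).
Variables (D : idomainType) (rho : {rmorphism D -> K}) (w : D).
Hypothesis D_tame : tame rho w.
Variable i : {rmorphism R -> D}.
Implicit Types phi psi : {rmorphism pseries R -> D}.

(** A point of the open disc over [D] is given by evaluation at it; its coordinate
    is the value of [psX R]. *)
Definition disc_point (phi : pseries R -> D) :=
  (forall c, phi (psC R c) = i c) /\ (forall f, rho (phi f) = res (f 0%N)).

Lemma tame_divX t x : rho t = 0 -> x != 0 -> exists N y, t ^+ N = y * x.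
Proof.
case: D_tame => _ _ divD radD /radD[m [y Ey]] /divD[n [z Ez]].
by exists (m * n)%N, (y ^+ n * z); rewrite exprM Ey exprMn Ez mulrA.
Qed.

(** A form of Krull's intersection theorem: a nonzero [x] divides some [t ^+ N], and as [t ^+ N.+1]
    divides [x], [t] would be a unit. *)
Lemma tame_separated t x :
  rho t = 0 -> (forall N, exists y, x = t ^+ N * y) -> x = 0.
Proof.
move=> rt xt; apply/eqP; case: eqP => // /eqP x0.
have [N [y Ey]] := tame_divX rt x0; have [z Ez] := xt N.+1.
have /(mulIf x0) E1 : t * y * z * x = 1 * x.
  by rewrite mul1r {2}Ez exprS Ey; ring.
by move/eqP: (congr1 rho E1); rewrite !rmorphM rt !mul0r rmorph1 eq_sym oner_eq0.
Qed.

(** Principal ideals are closed for the [t]-adic topology: if [y] is nonzero, the error [t ^+ N * r]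
    is itself a multiple of [y] for large [N]. *)
Lemma tame_closed t x y : rho t = 0 ->
  (forall N, exists v r, x = y * v + t ^+ N * r) -> exists v, x = y * v.
Proof.
move=> rt xt; have [y0|y0] := eqVneq y 0.
  exists 0; rewrite mulr0; apply: (tame_separated rt) => N.
  by have [v [r Er]] := xt N; exists r; rewrite Er y0 mul0r add0r.
have [N [z Ez]] := tame_divX rt y0; have [v [r ->]] := xt N.
by exists (v + z * r); rewrite Ez mulrDr mulrA [y * z]mulrC.
Qed.

Lemma point_res phi :
  disc_point phi -> rho (phi (psX R)) = 0.
Proof. by case=> _ ->; exact: rmorph0. Qed.

Lemma point_decomp phi f :
  disc_point phi -> phi f = i (f 0%N) + phi (psX R) * phi (ps_shift f).
Proof. by case=> phiC _; rewrite {1}[f]ps_decomp rmorphD rmorphM phiC. Qed.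

(** Peeling off [N] constant terms gives the divisibility up to a multiple of the [N]-th power of
    the coordinate; [tame_closed] replaces the passage to the limit. *)
Lemma point_dvd phi psi f :
    disc_point phi -> disc_point psi ->
  exists v, phi f - psi f = (phi (psX R) - psi (psX R)) * v.
Proof.
move=> ptphi ptpsi; apply: (tame_closed (point_res ptphi)) => N.
elim: N f => [|N IHN] f.
  by exists 0, (phi f - psi f); rewrite mulr0 add0r mul1r.
have [v [r E]] := IHN (ps_shift f).
exists (phi (psX R) * v + psi (ps_shift f)), r.
rewrite (point_decomp f ptphi) (point_decomp f ptpsi).
rewrite -[phi (ps_shift f)](subrK (psi (ps_shift f))) E exprS; ring.
Qed.

(** Points are ring morphisms with no continuity assumed; still, the coordinate determines them. *)
Lemma point_eq phi psi f :
  disc_point phi -> disc_point psi -> phi (psX R) = psi (psX R) -> phi f = psi f.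
Proof.
move=> ptphi ptpsi E; apply/eqP; rewrite -subr_eq0.
by have [v ->] := point_dvd f ptphi ptpsi; rewrite E subrr mul0r.
Qed.

Lemma point_dvd_res phi psi f :
    disc_point phi -> disc_point psi ->
  exists v, phi f - psi f = (phi (psX R) - psi (psX R)) * v /\
    rho v = res (f 1%N).
Proof.
move=> ptphi ptpsi; have [v E] := point_dvd (ps_shift f) ptphi ptpsi.
exists (phi (psX R) * v + psi (ps_shift f)); split.
  rewrite (point_decomp f ptphi) (point_decomp f ptpsi).
  rewrite -[phi (ps_shift f)](subrK (psi (ps_shift f))) E; ring.
by rewrite rmorphD rmorphM point_res // mul0r add0r; case: ptpsi => _ ->.
Qed.

Definition taylor_at phi :
  {rmorphism pseries R -> pseries D} := ps_map phi \o @taylor R.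

Lemma taylor_at0 phi f : taylor_at phi f 0%N = phi f.
Proof.
rewrite /taylor_at /= /ps_map /=; congr (phi _).
by apply: psP => m; rewrite /taylor add0n bin0.
Qed.

Lemma taylor_atC phi c : disc_point phi -> taylor_at phi (psC R c) = psC D (i c).
Proof.
by case=> phiC _; rewrite -phiC -ps_mapC -taylorC.
Qed.

Lemma taylor_atX phi : taylor_at phi (psX R) = psC D (phi (psX R)) + psX D.
Proof.
rewrite -(ps_mapX phi) -ps_mapC -rmorphD -taylorX //.
Qed.

Lemma taylor_at_res phi f n : disc_point phi -> rho (taylor_at phi f n) = res (f n).
Proof.
case=> _ phi_res; rewrite /taylor_at /= /ps_map /= phi_res /taylor addn0 binn.
by [].
Qed.

Definition derivation_at (phi d : pseries R -> D) :=
  [/\ forall f g, d (f + g) = d f + d g, forall c, d (psC R c) = 0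
    & forall f g, d (f * g) = phi f * d g + d f * phi g].

(** Each constant term peeled off [f] brings out a factor [phi (psX R)] in [d f], which is thus
    infinitely divisible. *)
Lemma derivation_eq0 phi d f :
  disc_point phi -> derivation_at phi d -> d (psX R) = 0 -> d f = 0.
Proof.
move=> ptphi [dD dC dM] dX; apply: (tame_separated (point_res ptphi)) => N.
elim: N f => [|N IHN] f; first by exists (d f); rewrite mul1r.
have [y Ey] := IHN (ps_shift f); exists y.
by rewrite {1}[f]ps_decomp dD dC dM dX mul0r add0r addr0 Ey exprS mulrA.
Qed.

Definition diff_at phi f : D := taylor_at phi f 1%N.

Lemma diff_at_derivation phi : disc_point phi -> derivation_at phi (diff_at phi).
Proof.
move=> ptphi; split=> [f g|c|f g]; rewrite /diff_at.
- by rewrite rmorphD.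
- by rewrite taylor_atC // coefpsC.
- by rewrite rmorphM coef1psM !taylor_at0.
Qed.

Lemma diff_atX phi : diff_at phi (psX R) = 1.
Proof.
rewrite /diff_at taylor_atX.
by rewrite [LHS](_ : _ = psC D (phi (psX R)) 1%N + 1) // coefpsC add0r.
Qed.

Lemma derivationE phi d f :
  disc_point phi -> derivation_at phi d -> d f = d (psX R) * diff_at phi f.
Proof.
move=> ptphi der_d; have [eD eC eM] := diff_at_derivation ptphi.
have [dD dC dM] := der_d.
apply/eqP; rewrite -subr_eq0; apply/eqP.
apply: (@derivation_eq0 phi (fun f => d f - d (psX R) * diff_at phi f)) => //.
  split=> [g h|c|g h]; rewrite ?dD ?eD ?dC ?eC ?dM ?eM; ring.
by rewrite diff_atX mulr1 subrr.
Qed.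

Definition trunc_poly n (f : pseries R) : {poly D} := \poly_(l < n) i (f l).

Lemma trunc_polyS n f :
  trunc_poly n.+1 f = trunc_poly n (ps_shift f) * 'X + (i (f 0%N))%:P.
Proof.
apply/polyP => l; rewrite coefD coefMX coefC !coef_poly.
by case: l => [|l] /=; rewrite ?add0r ?addr0.
Qed.

Lemma point_trunc phi n f : disc_point phi ->
  exists v, phi f = (trunc_poly n f).[phi (psX R)] + phi (psX R) ^+ n * v.
Proof.
move=> ptphi; elim: n f => [|n IHn] f.
  by exists (phi f); rewrite /trunc_poly poly_def big_ord0 horner0 add0r mul1r.
have [v Ev] := IHn (ps_shift f); exists v.
rewrite (point_decomp f ptphi) Ev trunc_polyS hornerMXaddC exprS; ring.
Qed.

(** Differentiation loses one order, hence the truncation at [n.+1] for an error of order [n]. *)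
Lemma diff_trunc phi n f : disc_point phi ->
  exists v, diff_at phi f =
    ((trunc_poly n.+1 f)^`()).[phi (psX R)] + phi (psX R) ^+ n * v.
Proof.
move=> ptphi; have [eD eC eM] := diff_at_derivation ptphi.
elim: n f => [|n IHn] f.
  exists (diff_at phi f); rewrite trunc_polyS /trunc_poly poly_def big_ord0.
  by rewrite mul0r add0r derivC horner0 add0r mul1r.
have [v Ev] := IHn (ps_shift f).
have [u Eu] := point_trunc n.+1 (ps_shift f) ptphi.
exists (v + u); rewrite {1}[f]ps_decomp eD eC eM diff_atX Ev Eu.
rewrite (trunc_polyS n.+1 f) derivD derivC derivM derivX addr0 mulr1.
rewrite hornerD hornerMX exprS; ring.
Qed.

Hypothesis rho_i : forall c, rho (i c) = res c.

Lemma common_exponent (ts : seq D) x : (forall t, t \in ts -> rho t = 0) -> x != 0 ->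
  exists N0, forall N t, (N0 <= N)%N -> t \in ts -> exists c, t ^+ N = c * x.
Proof.
move=> rts x0; elim: ts rts => [|t ts IHts] rts; first by exists 0%N.
have [N1 EN1] : exists N0, forall N t, (N0 <= N)%N -> t \in ts ->
    exists c, t ^+ N = c * x.
  by apply: IHts => u uts; apply: rts; rewrite inE uts orbT.
have [N2 [c Ec]] := tame_divX (rts t (mem_head _ _)) x0.
exists (maxn N1 N2) => N u; rewrite geq_max inE => /andP[le1 le2] /predU1P[->|uts].
  by exists (t ^+ (N - N2) * c); rewrite -mulrA -Ec -exprD subnK.
exact: EN1.
Qed.

Definition zero_point f y := exists phi, [/\ disc_point phi, phi (psX R) = y & phi f = 0].

Lemma zero_point_res f y : zero_point f y -> rho y = 0.
Proof. by case=> phi [ptphi <- _]; exact: point_res. Qed.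

Lemma map_prod_res (ys : seq D) : (forall y, y \in ys -> rho y = 0) ->
  map_poly rho (\prod_(y <- ys) ('X - y%:P)) = 'X^(size ys).
Proof.
elim: ys => [|y ys IHys] rys; first by rewrite big_nil rmorph1.
rewrite big_cons rmorphM rmorphB /= map_polyX map_polyC /= rys ?mem_head // subr0.
by rewrite IHys ?exprS // => z zys; apply: rys; rewrite inE zys orbT.
Qed.

Lemma horner_res (q : {poly D}) x : rho x = 0 -> rho q.[x] = rho q`_0.
Proof. by move=> rx; rewrite -horner_map rx horner_coef0 coef_map. Qed.

(** [f] is replaced by a truncation, which vanishes at the points [ys] up to an
    error small enough to be absorbed by the interpolation denominators. *)
Lemma trunc_division (ts ys : seq D) f (d : D) :
    uniq ys -> (forall y, y \in ys -> zero_point f y) ->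
    d != 0 -> rho d = 0 -> (forall t, t \in ts -> rho t = 0) ->
  exists N (q r : {poly D}),
    [/\ trunc_poly N.+1 f = q * \prod_(y <- ys) ('X - y%:P) + d *: r,
        rho q`_0 = res (f (size ys)) & forall t, t \in ts -> exists c, t ^+ N = c * d].
Proof.
move=> uniq_ys zys d0 rd rts.
have rys y : y \in ys -> rho y = 0 by move/zys/zero_point_res.
have [E E0 IHE] := poly_interpolation uniq_ys d0.
have Ed0 : E * d != 0 by rewrite mulf_neq0.
have [N0 EN0] : exists N0, forall N t, (N0 <= N)%N -> t \in ts ++ ys ->
    exists c, t ^+ N = c * (E * d).
  by apply: common_exponent => // t; rewrite mem_cat => /orP[/rts|/rys].
(* The bound [size ys] keeps the coefficient of that index in the truncation. *)
pose N := maxn N0 (size ys); exists N.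
have [y yys|q [r Eqr]] := IHE (trunc_poly N.+1 f).
  have [phi [ptphi Ey phif]] := zys y yys.
  have [v Ev] := point_trunc N.+1 f ptphi.
  have [c Ec] : exists c, y ^+ N = c * (E * d).
    by apply: EN0; rewrite ?leq_maxl // mem_cat yys orbT.
  exists (- (y * c * d * v)); move/eqP: phif; rewrite Ev Ey addr_eq0 => /eqP ->.
  by rewrite exprS Ec; ring.
exists q, r; split=> // [|t tts].
  (* Under [rho] the product becomes ['X^(size ys)] and [d] vanishes, so this coefficient is the
     constant one of [q]. *)
  have := congr1 (fun s : {poly D} => rho s`_(size ys)) Eqr.
  rewrite coef_poly ltnS leq_maxr rho_i => ->.
  rewrite -!coef_map rmorphD rmorphM /= map_prod_res // map_polyZ /= rd scale0r.
  by rewrite addr0 coefMXn ltnn subnn.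
have [c Ec] : exists c, t ^+ N = c * (E * d).
  by apply: EN0; rewrite ?leq_maxl // mem_cat tts.
by exists (c * E); rewrite Ec mulrA.
Qed.

(** The zeros are divided out of a truncation. With [d = V * w], the errors are multiples of
    [V * w], so they are absorbed in the quotient without changing its residue. *)
Lemma point_factor phi f (ys : seq D) :
    disc_point phi -> uniq ys -> (forall y, y \in ys -> zero_point f y) ->
  exists q, phi f = q * \prod_(y <- ys) (phi (psX R) - y) /\
    rho q = res (f (size ys)).
Proof.
move=> ptphi uniq_ys zys; set x := phi (psX R); set V := \prod_(y <- ys) _.
have rx : rho x = 0 by exact: point_res.
have [/eqP V0|V0] := eqVneq V 0.
  (* The point is one of the zeros and both sides vanish, so only the residue of [q] matters. *)
  exists (i (f (size ys))); rewrite rho_i; split=> //.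
  move: V0; rewrite prodf_seq_eq0 => /hasP[y yys /=]; rewrite subr_eq0 => /eqP Exy.
  have [psi [ptpsi Ey psif]] := zys y yys.
  rewrite (_ : V = 0) ?mulr0; first by rewrite (point_eq f ptphi ptpsi) // Ey.
  by apply/eqP; rewrite prodf_seq_eq0; apply/hasP; exists y; rewrite //= Exy subrr.
have [[w0 rw] _ _ _] := D_tame.
have [||t|N [q [r [EP rq dt]]]] := @trunc_division [:: x] ys f (V * w) uniq_ys zys.
- by rewrite mulf_neq0.
- by rewrite rmorphM rw mulr0.
- by rewrite inE => /eqP ->.
have [c Ec] := dt x (mem_head _ _); have [v Ev] := point_trunc N.+1 f ptphi.
exists (q.[x] + w * (r.[x] + x * c * v)).
rewrite rmorphD [rho (w * _)]rmorphM rw mul0r addr0 horner_res //; split=> //.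
rewrite Ev EP -/x hornerD hornerM hornerZ horner_prod exprS Ec.
rewrite (eq_bigr (fun y => x - y)) => [|y _]; last by rewrite hornerXsubC.
rewrite -/V; ring.
Qed.

(** The zero [x] is divided out as well; in the derivative at [x], the main term survives only where
    the factor ['X - x%:P] is differentiated. *)
Lemma diff_factor phi f (ys : seq D) :
    disc_point phi -> phi f = 0 -> uniq (phi (psX R) :: ys) ->
    (forall y, y \in ys -> zero_point f y) ->
  exists q, diff_at phi f = q * \prod_(y <- ys) (phi (psX R) - y) /\
    rho q = res (f (size ys).+1).
Proof.
move=> ptphi phif uniq_ys zys; set x := phi (psX R); set V := \prod_(y <- ys) _.
have rx : rho x = 0 by exact: point_res.
have V0 : V != 0.
  rewrite prodf_seq_neq0; apply/allP => y yys /=; rewrite subr_eq0.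
  by case/andP: uniq_ys => + _; apply: contraNneq; rewrite -/x => ->.
have [[w0 rw] _ _ _] := D_tame.
have zxys y : y \in x :: ys -> zero_point f y.
  by rewrite inE => /predU1P[->|/zys//]; exists phi.
have [||t|N [q [r [EP rq dt]]]] := @trunc_division [:: x] (x :: ys) f (V * w) uniq_ys zxys.
- by rewrite mulf_neq0.
- by rewrite rmorphM rw mulr0.
- by rewrite inE => /eqP ->.
have [c Ec] := dt x (mem_head _ _); have [v Ev] := diff_trunc N f ptphi.
exists (q.[x] + w * ((r^`()).[x] + c * v)).
rewrite rmorphD [rho (w * _)]rmorphM rw mul0r addr0 horner_res //; split=> //.
rewrite Ev EP -/x big_cons derivD derivM derivZ derivM derivXsubC.
rewrite mul1r !(hornerXsubC, hornerD, hornerM, hornerZ) subrr horner_prod Ec.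
rewrite (eq_bigr (fun y => x - y)) => [|y _]; last by rewrite hornerXsubC.
rewrite -/V; ring.
Qed.

End Points.

(** * Fixed points of commuting automorphisms *)

Lemma natr_pchar_inj (K : fieldType) p n m : p \in [pchar K] ->
  (n < p)%N -> (m < p)%N -> n%:R = m%:R :> K -> n = m.
Proof.
move=> char_K; wlog le_nm : n m / (n <= m)%N => [IH lt_n lt_m E|_ lt_m E].
  by case/orP: (leq_total n m) => /IH; [apply|move=> H; apply/esym/H].
apply/eqP; rewrite eqn_leq le_nm /= -subn_eq0; apply: contraT; rewrite -lt0n.
move=> /dvdn_leq le_p; have /le_p : (p %| m - n)%N.
  by rewrite (dvdn_pcharf char_K) natrB // E subrr.
by rewrite leqNgt (leq_ltn_trans (leq_subr _ _) lt_m).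
Qed.

(** As [p] is prime, [z2] is a primitive root, and its [p] powers exhaust the roots of ['X^p - 1] in
    a domain. *)
Lemma unity_root_power (D : idomainType) p (z1 z2 : D) :
  prime p -> z1 ^+ p = 1 -> z2 ^+ p = 1 -> z2 != 1 -> exists2 h, (h < p)%N & z1 = z2 ^+ h.
Proof.
move=> p_pr z1p z2p z2_1.
have [m prim_m] := prim_order_exists (prime_gt0 p_pr) z2p.
case/primeP: (p_pr) => _ pdiv /pdiv/orP[/eqP m1|/eqP mp].
  by move: (prim_expr_order prim_m) z2_1; rewrite m1 expr1 => ->; rewrite eqxx.
rewrite mp in prim_m.
pose zs := [seq z2 ^+ h | h <- iota 0 p].
have [/mapP[h]|z1_zs] := boolP (z1 \in zs).
  by rewrite mem_iota => lt_hp ->; exists h.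
have size_P := size_XnsubC (1 : D) (prime_gt0 p_pr).
have P0 : 'X^p - 1%:P != 0 :> {poly D} by rewrite -size_poly_gt0 size_P.
have uniq_rs : uniq (z1 :: zs).
  rewrite /= z1_zs map_inj_in_uniq ?iota_uniq // => h l.
  rewrite !mem_iota !add0n => /= lt_h lt_l /eqP.
  by rewrite (eq_prim_root_expr prim_m) !modn_small // => /eqP.
suff /max_poly_roots/(_ uniq_rs) : all (root ('X^p - 1%:P)) (z1 :: zs).
  by move=> /(_ P0); rewrite size_P /= size_map size_iota ltnn.
apply/andP; split; first by rewrite rootE !hornerE z1p subrr.
apply/allP => _ /mapP[h _ ->].
by rewrite rootE !hornerE exprAC z2p expr1n subrr.
Qed.

Section Action.
Variables (R : comNzRingType) (K : fieldType) (res : {rmorphism R -> K}).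
Variables (D : idomainType) (rho : {rmorphism D -> K}) (w : D).
Hypothesis D_tame : tame rho w.
Variable i : {rmorphism R -> D}.
Hypothesis rho_i : forall c, rho (i c) = res c.
Variables (G : finGroupType) (Sigma : ps_aut_group G R).
Implicit Types (g s t : G) (phi psi : {rmorphism pseries R -> D}).

Definition pact g : {rmorphism pseries R -> pseries R} := Sigma g.

Definition displ g : pseries R := pact g (psX R) - psX R.

Variable p : nat.
Hypotheses (p_pr : prime p) (p_odd : (2 < p)%N).
Hypothesis displ_low : forall g n, (n < p)%N -> res (displ g n) = 0.
Hypothesis displ_lead : forall g, g != 1%g -> res (displ g p) != 0.
Hypothesis char_K : p \in [pchar K].
Hypothesis p_neq0 : p%:R != 0 :> D.
Hypothesis expG : forall g, (g ^+ p)%g = 1%g.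
Hypothesis commG : forall s t : G, (s * t)%g = (t * s)%g.

Local Notation pt := (disc_point res rho i).

Lemma pact1 f : pact 1%g f = f.
Proof. exact: aut1. Qed.

Lemma pactM s t f : pact (s * t)%g f = pact s (pact t f).
Proof. exact: autM. Qed.

Lemma pact_psC g c : pact g (psC R c) = psC R c.
Proof.
rewrite [LHS](_ : _ = Sigma g (c *: 1)) // linearZ; congr (c *: _); exact: rmorph1.
Qed.

Lemma pact_res g f : res (pact g f 0%N) = res (f 0%N).
Proof.
rewrite {1}[f]ps_decomp rmorphD rmorphM pact_psC.
rewrite [X in res X](_ : _ = f 0%N + (pact g (psX R) * pact g (ps_shift f)) 0%N) //.
  rewrite rmorphD ps_const0M rmorphM.
  have -> : pact g (psX R) 0%N = displ g 0%N by rewrite /displ [RHS]subr0.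
  by rewrite displ_low ?prime_gt0 // mul0r addr0.
by rewrite -[in RHS](coefpsC (f 0%N) 0%N).
Qed.

Definition pmove phi g : {rmorphism pseries R -> D} := phi \o pact g.

Lemma pmove_point phi g : pt phi -> pt (pmove phi g).
Proof.
case=> phiC phi_res; split=> [c|f]; rewrite /pmove /=.
  by rewrite pact_psC.
by rewrite phi_res pact_res.
Qed.

Lemma displE g : pact g (psX R) = psX R + displ g.
Proof. by rewrite addrC subrK. Qed.

(** Moving the point by [t] multiplies the displacement by a factor congruent to 1, since the
    coefficient of index 1 of [displ t] has residue 0. *)
Lemma displ_iter phi t n : pt phi ->
  exists u, phi (pact (t ^+ n)%g (displ t)) = phi (displ t) * u /\ rho u = 1.
Proof.
move=> ptphi; elim: n => [|n [u [Eu ru]]].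
  by exists 1; rewrite expg0 pact1 mulr1 rmorph1.
pose psi := pmove phi (t ^+ n)%g.
have ptpsi : pt psi by exact: pmove_point.
have [v [Ev rv]] :=
  point_dvd_res D_tame (displ t) (pmove_point t ptpsi) ptpsi.
exists (u * (1 + v)); rewrite (rmorphM rho) (rmorphD rho) (rmorph1 rho) ru rv; split; last first.
  by rewrite displ_low ?prime_gt1 // addr0 mulr1.
have {}Ev : psi (pact t (displ t)) - psi (displ t) = psi (displ t) * v.
  by rewrite Ev; congr (_ * _); exact: esym (rmorphB psi (pact t (psX R)) (psX R)).
have {}Eu : psi (displ t) = phi (displ t) * u by [].
rewrite expgSr pactM -[LHS]/(psi (pact t (displ t))) -[LHS](subrK (psi (displ t))).
by rewrite Ev Eu; ring.
Qed.

(** A telescoping sum of [n] displacements, each congruent to the first one up to a factor of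
    residue 1. *)
Lemma displ_pow phi t n : pt phi ->
  exists u, phi (pact (t ^+ n)%g (psX R)) - phi (psX R) = phi (displ t) * u /\
    rho u = n%:R.
Proof.
move=> ptphi; elim: n => [|n [u [Eu ru]]].
  by exists 0; rewrite expg0 pact1 mulr0 subrr rmorph0.
have [v [Ev rv]] := displ_iter t n ptphi.
exists (u + v); rewrite (rmorphD rho) ru rv -natr1; split=> //.
by rewrite expgSr pactM displE (rmorphD (pact _)) (rmorphD phi) Ev mulrDr -Eu addrAC.
Qed.

Definition fixes phi g := phi (displ g) = 0.

Lemma fixesE phi g f : pt phi -> fixes phi g -> phi (pact g f) = phi f.
Proof.
move=> ptphi fg; apply: (point_eq D_tame f (pmove_point g ptphi) ptphi).
by rewrite /= displE rmorphD fg addr0.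
Qed.

Lemma fixes1 phi : fixes phi 1%g.
Proof. by rewrite /fixes /displ pact1 subrr rmorph0. Qed.

Lemma fixesM phi s t : pt phi -> fixes phi s -> fixes phi t -> fixes phi (s * t)%g.
Proof.
move=> ptphi fs ft; rewrite /fixes /displ pactM rmorphB (fixesE _ ptphi fs).
by rewrite (fixesE _ ptphi ft) subrr.
Qed.

Lemma fixesX phi s n : pt phi -> fixes phi s -> fixes phi (s ^+ n)%g.
Proof.
move=> ptphi fs; elim: n => [|n IHn]; first exact: fixes1.
by rewrite expgS; apply: fixesM.
Qed.

Lemma fixesV phi s : pt phi -> fixes phi s -> fixes phi s^-1%g.
Proof.
move=> ptphi fs; rewrite /fixes /displ rmorphB.
by rewrite -[X in X - _](fixesE _ ptphi fs) -pactM mulgV pact1 subrr.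
Qed.

Definition multiplier phi g : D := diff_at phi (pact g (psX R)).

(** The chain rule at a fixed point: differentiating after [g] is again a derivation at [phi], hence
    a multiple of [diff_at phi]. *)
Lemma diff_at_pact phi g f : pt phi -> fixes phi g ->
  diff_at phi (pact g f) = multiplier phi g * diff_at phi f.
Proof.
move=> ptphi fg; have [eD eC eM] := diff_at_derivation ptphi.
apply: (derivationE D_tame f ptphi (d := fun f => diff_at phi (pact g f))).
split=> [f1 f2|c|f1 f2]; first by rewrite rmorphD eD.
  by rewrite pact_psC.
by rewrite rmorphM eM !fixesE.
Qed.

Lemma multiplierM phi s t : pt phi -> fixes phi s ->
  multiplier phi (s * t)%g = multiplier phi s * multiplier phi t.
Proof. by move=> ptphi fs; rewrite /multiplier pactM diff_at_pact. Qed.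

Lemma multiplierX phi s n : pt phi -> fixes phi s ->
  multiplier phi (s ^+ n)%g = multiplier phi s ^+ n.
Proof.
move=> ptphi fs; elim: n => [|n IHn].
  by rewrite expr0 /multiplier expg0 pact1 diff_atX.
by rewrite expgS exprS multiplierM ?IHn.
Qed.

Lemma multiplier_unity phi s : pt phi -> fixes phi s -> multiplier phi s ^+ p = 1.
Proof.
by move=> ptphi fs; rewrite -multiplierX // expG /multiplier pact1 diff_atX.
Qed.

(** If [g - 1] maps all series into those vanishing to order [n] at the point, the
    n-th Taylor coefficient of [g f - f] is a derivation [c] with
    [c \o g = c], so that of [g ^ p f - f = 0] is [p * c f]; hence [c = 0]. *)
Lemma tangent_identity phi g n f : pt phi -> fixes phi g ->
  multiplier phi g = 1 -> taylor_at phi (pact g f - f) n = 0.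
Proof.
move=> ptphi fg mg; elim/ltn_ind: n f => n IHn f.
pose T := taylor_at phi.
have TB h : T (pact g h - h) n = T (pact g h) n - T h n by rewrite rmorphB.
case: n => [|[|n]] in IHn TB *.
- by rewrite TB !taylor_at0 fixesE // subrr.
- by rewrite TB [X in X - _](diff_at_pact _ ptphi fg) mg mul1r subrr.
set m := n.+2 in IHn TB *.
pose c h := T (pact g h - h) m.
have derc : derivation_at phi c.
  split=> [h1 h2|a|h1 h2]; rewrite /c.
  - rewrite -[RHS]/((T (pact g h1 - h1) + T (pact g h2 - h2)) m) -rmorphD.
    by congr (T _ m); rewrite rmorphD; ring.
  - by rewrite pact_psC subrr rmorph0.
  (* The Taylor coefficients of [pact g h - h] below [m] vanish by induction, so in each product
     only the constant term of the other factor contributes. *)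
  have -> : pact g (h1 * h2) - h1 * h2 =
      h1 * (pact g h2 - h2) + (pact g h1 - h1) * pact g h2.
    by rewrite rmorphM; ring.
  rewrite rmorphD !rmorphM.
  rewrite -[LHS]/((T h1 * T (pact g h2 - h2)) m + (T (pact g h1 - h1) * T (pact g h2)) m).
  rewrite coefpsM_high => [|l lt_lm]; last exact: IHn.
  rewrite (mulrC (T (pact g h1 - h1))) coefpsM_high => [|l lt_lm]; last exact: IHn.
  by rewrite /T !taylor_at0 fixesE // [X in _ + X]mulrC.
have cE h k : c (pact (g ^+ k)%g h) = c h.
  rewrite (derivationE D_tame (pact (g ^+ k)%g h) ptphi derc).
  rewrite (derivationE D_tame h ptphi derc).
  by rewrite (diff_at_pact _ ptphi (fixesX k ptphi fg)) multiplierX // mg expr1n mul1r.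
have iterc k : T (pact (g ^+ k)%g f) m = T f m + c f *+ k.
  elim: k => [|k IHk]; first by rewrite expg0 pact1 addr0.
  rewrite expgS pactM -[LHS](subrK (T (pact (g ^+ k)%g f) m)) -TB.
  by rewrite [X in X + _]cE IHk mulrS; ring.
have := iterc p; rewrite expG pact1 -[LHS]addr0 => /addrI/esym.
by rewrite -mulr_natl => /eqP; rewrite mulf_eq0 (negPf p_neq0) => /eqP.
Qed.

(** Otherwise all Taylor coefficients of [displ g] at [phi] would vanish, whereas the one of index
    [p] has nonzero residue. *)
Lemma multiplier_neq1 phi g : pt phi -> fixes phi g -> g != 1%g ->
  multiplier phi g != 1.
Proof.
move=> ptphi fg g1; apply/eqP => mg; have := displ_lead g1.
by rewrite -(taylor_at_res (displ g) p ptphi) tangent_identity // rmorph0 eqxx.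
Qed.

(** The multipliers of [s] and [t] would be p-th roots of unity of the domain [D],
    hence some [s^-1 * t ^ k] would have multiplier 1. *)
Lemma no_common_fixed_point phi s t : pt phi -> t != 1%g ->
  (forall k, s <> (t ^+ k)%g) -> fixes phi s -> fixes phi t -> False.
Proof.
move=> ptphi t1 s_t fs ft.
have [k _ Ek] := unity_root_power p_pr (multiplier_unity ptphi fs)
  (multiplier_unity ptphi ft) (multiplier_neq1 ptphi ft t1).
have fsV := fixesV ptphi fs; have ftk := fixesX k ptphi ft.
have g1 : (s^-1 * t ^+ k)%g != 1%g.
  by apply/eqP => /(congr1 (mulg s)); rewrite mulKVg mulg1 => /esym/s_t.
have fg := fixesM ptphi fsV ftk.
have s0 : multiplier phi s != 0.
  apply/eqP => s0; have := multiplier_unity ptphi fs.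
  by move/eqP; rewrite s0 expr0n gtn_eqF ?prime_gt0 // eq_sym oner_eq0.
have /eqP := multiplier_neq1 ptphi fg g1; apply; apply: (mulfI s0).
by rewrite mulr1 -multiplierM // mulKVg multiplierX.
Qed.

(** The distances to [phi], divided by [phi (displ t)], have the distinct residues [l%:R]. *)
Lemma orbit_uniq phi t : pt phi -> phi (displ t) != 0 ->
  uniq [seq phi (pact (t ^+ l)%g (psX R)) | l <- iota 0 p].
Proof.
move=> ptphi t0; rewrite map_inj_in_uniq ?iota_uniq // => l m.
rewrite !mem_iota !add0n /= => lt_l lt_m E.
have [u [Eu ru]] := displ_pow t l ptphi; have [v [Ev rv]] := displ_pow t m ptphi.
apply: (natr_pchar_inj char_K lt_l lt_m); rewrite -ru -rv; congr (rho _).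
by apply: (mulfI t0); rewrite -Eu -Ev E.
Qed.

Lemma orbit_zero phi s t l : pt phi -> fixes phi s ->
  zero_point res rho i (displ s) (phi (pact (t ^+ l)%g (psX R))).
Proof.
move=> ptphi fs; exists (pmove phi (t ^+ l)%g); split=> //.
  exact: pmove_point.
rewrite -[LHS]/(phi (pact (t ^+ l)%g (displ s))) (rmorphB (pact _)) rmorphB.
by rewrite -pactM commG pactM fixesE // subrr.
Qed.

Lemma odd_p : odd p.
Proof. by apply: contraLR p_odd; case/even_prime: p_pr => ->. Qed.

(** Wilson's theorem, used for the product of the distances from a point to the rest of its orbit,
    measured by the displacement. *)
Lemma wilson_pchar : \prod_(l <- iota 1 p.-1) (- l%:R) = -1 :> K.
Proof.
have -> : \prod_(l <- iota 1 p.-1) (- l%:R) =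
    (-1) ^+ p.-1 * (\prod_(l <- iota 1 p.-1) l)%:R :> K.
  rewrite -[X in _ ^+ X](size_iota 1); elim: (iota 1 p.-1) => [|l ls IHls].
    by rewrite !big_nil mul1r.
  by rewrite !big_cons IHls exprS natrM; ring.
have -> : (\prod_(l <- iota 1 p.-1) l)%N = (p.-1)`!.
  by rewrite fact_prod prednK ?prime_gt0 // /index_iota subn1.
have : (p %| (p.-1)`!.+1)%N by rewrite -Wilson ?prime_gt1.
rewrite (dvdn_pcharf char_K) -natr1 addr_eq0 => /eqP ->.
by rewrite -signr_odd; case: (p) odd_p p_odd => [|n] //= /negPf ->; rewrite mul1r.
Qed.

(** The [p] fixed points of [s] are the orbit of [phi] under [t], so
    [displ s] at [psi] is the product of the distances from [psi] to that orbit;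
    it is thus infinitely smaller than [phi (psX R) - psi (psX R)]. *)
Lemma orbit_close phi psi s t l : pt phi -> pt psi -> fixes phi s -> fixes psi t ->
    phi (displ t) != 0 ->
  exists m, phi (psX R) - psi (pact (s ^+ l)%g (psX R)) =
    (phi (psX R) - psi (psX R)) * m /\ rho m = 1.
Proof.
move=> ptphi ptpsi fs ft t0.
have [u [Eu _]] := displ_pow s l ptpsi.
have zs y : y \in [seq phi (pact (t ^+ l)%g (psX R)) | l <- iota 0 p] ->
    zero_point res rho i (displ s) y.
  by case/mapP=> k _ ->; apply: orbit_zero.
have [q [Eq _]] := point_factor D_tame rho_i ptpsi (orbit_uniq ptphi t0) zs.
(* Two factors of the product are isolated: the first is the distance between the points up to sign,
   the second lies in the kernel of [rho] and makes [m] congruent to 1. *)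
case: p p_odd Eq => [|[|n]] // _; rewrite big_map /= !big_cons expg0 pact1.
set V := \prod_(_ <- _) _; set x1 := phi (pact _ _) => Eq.
have rx1 : rho x1 = 0 by have := point_res (pmove_point (t ^+ 1)%g ptphi).
exists (1 + q * (psi (psX R) - x1) * V * u); split.
  rewrite -[psi (pact _ _)](subrK (psi (psX R))) Eu Eq; ring.
by rewrite rmorphD rmorph1 !rmorphM rmorphB rx1 (point_res ptpsi) subrr mulr0 !mul0r addr0.
Qed.

(** [displ t] is factored over the orbit of [psi] under [s], all of whose points are at the same
    distance from [phi] up to factors of residue 1. *)
Lemma displ_power phi psi s t : pt phi -> pt psi -> fixes phi s -> fixes psi t ->
    phi (displ t) != 0 -> psi (displ s) != 0 ->
  exists u, phi (displ t) = u * (phi (psX R) - psi (psX R)) ^+ p /\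
    rho u = res (displ t p).
Proof.
move=> ptphi ptpsi fs ft t0 s0.
have zs y : y \in [seq psi (pact (s ^+ l)%g (psX R)) | l <- iota 0 p] ->
    zero_point res rho i (displ t) y.
  by case/mapP=> k _ ->; apply: orbit_zero.
have [q [Eq rq]] := point_factor D_tame rho_i ptphi (orbit_uniq ptpsi s0) zs.
move: rq; rewrite size_map size_iota => rq; rewrite Eq big_map.
suff [m [-> rm]] : exists m,
    \prod_(l <- iota 0 p) (phi (psX R) - psi (pact (s ^+ l)%g (psX R))) =
    m * (phi (psX R) - psi (psX R)) ^+ p /\ rho m = 1.
  by exists (q * m); rewrite mulrA rmorphM rm mulr1.
rewrite -[X in _ ^+ X](size_iota 0); elim: (iota 0 p) => [|l ls [m [Em rm]]].
  by exists 1; rewrite big_nil mulr1 rmorph1.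
have [v [Ev rv]] := orbit_close l ptphi ptpsi fs ft t0.
exists (v * m); rewrite big_cons Em Ev rmorphM rm rv mulr1; split=> //.
by rewrite exprS; ring.
Qed.

(** The left side is the derivative of [displ s] at its zero [phi], factored over the [p.-1] other
    points of the orbit; their distances to [phi] contribute the residues of Wilson's product. *)
Lemma multiplier_displ phi s t : pt phi -> fixes phi s -> phi (displ t) != 0 ->
  exists u, multiplier phi s - 1 = u * phi (displ t) ^+ p.-1 /\
    rho u = - res (displ s p).
Proof.
move=> ptphi fs t0.
have -> : multiplier phi s - 1 = diff_at phi (displ s).
  have [eD eC eM] := diff_at_derivation ptphi.
  by rewrite /multiplier displE eD diff_atX addrC addKr.
pose ys := [seq phi (pact (t ^+ l)%g (psX R)) | l <- iota 1 p.-1].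
have Eys : phi (psX R) :: ys = [seq phi (pact (t ^+ l)%g (psX R)) | l <- iota 0 p].
  by rewrite -[in RHS](prednK (prime_gt0 p_pr)) /= expg0 pact1.
have uniq_ys : uniq (phi (psX R) :: ys) by rewrite Eys; apply: orbit_uniq.
have zs y : y \in ys -> zero_point res rho i (displ s) y.
  by case/mapP=> k _ ->; apply: orbit_zero.
have [q [Eq rq]] := diff_factor D_tame rho_i ptphi fs uniq_ys zs.
move: rq; rewrite size_map size_iota prednK ?prime_gt0 // => rq.
rewrite Eq big_map.
suff [m [-> rm]] : exists m,
    \prod_(l <- iota 1 p.-1) (phi (psX R) - phi (pact (t ^+ l)%g (psX R))) =
    m * phi (displ t) ^+ p.-1 /\ rho m = -1.
  by exists (q * m); rewrite mulrA rmorphM rm mulrN1 rq.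
rewrite -wilson_pchar -[X in _ ^+ X](size_iota 1); elim: (iota 1 p.-1) => [|l ls [m [Em rm]]].
  by exists 1; rewrite !big_nil mulr1 rmorph1.
have [v [Ev rv]] := displ_pow t l ptphi.
exists (- v * m); rewrite !big_cons Em rmorphM rm rmorphN rv; split=> //.
by rewrite -opprB Ev exprS; ring.
Qed.

Lemma lead_ratio phi psi s t : pt phi -> pt psi -> fixes phi s -> fixes psi t ->
    phi (displ t) != 0 -> psi (displ s) != 0 ->
  exists h, res (displ t p) ^+ p.-2 = h%:R * res (displ s p) ^+ p.-2.
Proof.
move=> ptphi ptpsi fs ft t0 s0.
have [u1 [E1 r1]] := multiplier_displ ptphi fs t0.
have [u2 [E2 r2]] := multiplier_displ ptpsi ft s0.
have [u4 [E4 r4]] := displ_power ptphi ptpsi fs ft t0 s0.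
have [u5 [E5 r5]] := displ_power ptpsi ptphi ft fs s0 t0.
have at0 : res (displ t p) != 0.
  by apply: displ_lead; apply/eqP => t1; rewrite t1 /displ pact1 subrr rmorph0 eqxx in t0.
have as0 : res (displ s p) != 0.
  by apply: displ_lead; apply/eqP => s1; rewrite s1 /displ pact1 subrr rmorph0 eqxx in s0.
have u2_0 : u2 != 0 by apply: contraNneq at0 => u20; rewrite -oppr_eq0 -r2 u20 rmorph0.
have mt1 : multiplier psi t != 1.
  by rewrite -subr_eq0 E2 mulf_neq0 // expf_neq0.
have [h _ Eh] := unity_root_power p_pr (multiplier_unity ptphi fs)
  (multiplier_unity ptpsi ft) mt1.
exists h.
have rmt : rho (multiplier psi t) = 1.
  apply/eqP; rewrite -subr_eq0 -(rmorph1 rho) -rmorphB E2 rmorphM rmorphXn.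
  have -> : rho (psi (displ s)) = 0 by case: ptpsi => _ ->; apply: displ_low; apply: prime_gt0.
  by rewrite expr0n gtn_eqF ?mulr0 // -ltnS prednK ?prime_gt0 ?prime_gt1.
(* The geometric sum [1 + zeta + ... + zeta ^ (h - 1)] is congruent to [h], since [zeta] is
   congruent to 1. *)
have [u3 [E3 r3]] : exists u3,
    multiplier phi s - 1 = u3 * (multiplier psi t - 1) /\ rho u3 = h%:R.
  rewrite Eh; elim: h {Eh} => [|h [v [Ev rv]]].
    by exists 0; rewrite mul0r subrr rmorph0.
  exists (multiplier psi t * v + 1); rewrite rmorphD rmorphM rmt mul1r rmorph1 rv natr1.
  by split=> //; rewrite mulrDl -mulrA -Ev exprS; ring.
(* Both displacements are the [p]-th power of the same distance, with opposite signs as [p] is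
   odd. *)
have E45 : u5 * phi (displ t) = - u4 * psi (displ s).
  rewrite E4 E5 -[psi (psX R) - _]opprB exprNn -signr_odd odd_p; ring.
have Efin : u1 * u4 ^+ p.-1 = u3 * u2 * u5 ^+ p.-1.
  apply: (mulIf (expf_neq0 p.-1 s0)).
  have ev : (- 1) ^+ p.-1 = 1 :> D.
    by rewrite -signr_odd; case: (p) odd_p p_odd => [|n] //= /negPf ->.
  have := congr1 (fun x => u1 * x ^+ p.-1) E45; rewrite exprMn exprMn exprNn ev mul1r => E.
  have E123 : u1 * phi (displ t) ^+ p.-1 = u3 * (u2 * psi (displ s) ^+ p.-1).
    by rewrite -E2 -E3 E1.
  by rewrite -mulrA -E mulrCA E123; ring.
(* With [a g] the residue of the coefficient of index [p] of [displ g], the residues give [- a s * a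
   t ^ (p - 1) = - h * a t * a s ^ (p - 1)], from which [a s * a t] is cancelled. *)
have := congr1 rho Efin; rewrite !rmorphM !rmorphXn r1 r2 r3 r4 r5.
have -> : p.-1 = p.-2.+1 by case: (p) p_odd => [|[|n]].
rewrite !exprS => E.
apply: (mulfI as0); apply: (mulfI at0); apply: oppr_inj.
by move: E; rewrite !mulNr !mulrN !mulNr => /oppr_inj E; congr (- _); rewrite mulrCA E; ring.
Qed.

End Action.

(** * The residual contradiction *)

(** Two successive extensions: the first adjoins a zero of [F], the second a zero of the image of
    [G]. The point [phi] lives over the first and is carried to the second by constants. *)
Lemma two_points (R : idomainType) (K : fieldType) (res : {rmorphism R -> K}) (w : R)
    p (F G : pseries R) :
    tame res w -> (0 < p)%N ->
    (forall n, (n < p)%N -> res (F n) = 0) -> res (F p) != 0 ->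
    (forall n, (n < p)%N -> res (G n) = 0) -> res (G p) != 0 ->
  exists (D : idomainType) (rho : {rmorphism D -> K}) (i : {rmorphism R -> D})
      (phi psi : {rmorphism pseries R -> D}),
    [/\ tame rho (i w), forall c, rho (i c) = res c,
        disc_point res rho i phi, disc_point res rho i psi & phi F = 0 /\ psi G = 0].
Proof.
move=> R_tame p0 F_low F_p G_low G_p.
have [D1 [rho1 [e1 [tame1 e1F rho_e1]]]] := tame_extension R_tame p0 F_low F_p.
pose i1 : {rmorphism R -> D1} := e1 \o psC R.
have rho_i1 c : rho1 (i1 c) = res c.
  by rewrite -[LHS]/(rho1 (e1 (psC R c))) rho_e1; congr (res _); exact: coefpsC.
pose G1 := ps_map i1 G.
have G1_low n : (n < p)%N -> rho1 (G1 n) = 0.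
  by move=> lt_np; rewrite -[LHS]/(rho1 (i1 (G n))) rho_i1 G_low.
have G1_p : rho1 (G1 p) != 0 by rewrite -[X in X != 0]/(rho1 (i1 (G p))) rho_i1.
have [D [rho [e [tame2 eG rho_e]]]] := tame_extension tame1 p0 G1_low G1_p.
pose i : {rmorphism R -> D} := e \o psC D1 \o i1.
have rho_i c : rho (i c) = res c.
  rewrite -[LHS]/(rho (e (psC D1 (i1 c)))) rho_e -rho_i1.
  by congr (rho1 _); exact: coefpsC.
pose phi : {rmorphism pseries R -> D} := e \o psC D1 \o e1.
pose psi : {rmorphism pseries R -> D} := e \o ps_map i1.
exists D, rho, i, phi, psi; split=> //.
- split=> [//|f].
  rewrite -[LHS]/(rho (e (psC D1 (e1 f)))) rho_e -rho_e1.
  by congr (rho1 _); exact: coefpsC.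
- split=> [c|f]; first by rewrite -[LHS]/(e (ps_map i1 (psC R c))) ps_mapC.
  by rewrite -[LHS]/(rho (e (ps_map i1 f))) rho_e -rho_i1.
by split=> //; rewrite -[LHS]/(e (psC D1 (e1 F))) e1F !rmorph0.
Qed.

Lemma dvr_tame (R : idomainType) (K : fieldType) (res : {rmorphism R -> K}) :
  is_dvr R -> is_residue_field res -> exists w, tame res w.
Proof.
move=> [R_pid R_local [x0 x0_neq0 x0_nu]] res_surj.
(* If [x] were not a unit, locality would make [1 = (1 - x * y) + x * y] a nonunit, where [y] lifts
   the inverse of the residue of [x]. *)
have unitR x : res x != 0 -> exists y, x * y = 1.
  move=> rx; apply: contrapT => nu_x; have [y Ey] := res_surj (res x)^-1.
  have nu_xy : nonunit (x * y).
    by case=> z xyz; apply: nu_x; exists (y * z); rewrite mulrA.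
  have nu_1 : nonunit (1 - x * y).
    case=> z /(congr1 res); rewrite rmorphM rmorphB rmorphM rmorph1 Ey divff //.
    by rewrite subrr mul0r => /eqP; rewrite eq_sym oner_eq0.
  by have := R_local _ _ nu_1 nu_xy; rewrite subrK; apply; exists 1; rewrite mulr1.
have [|w wP] := R_pid (fun x => res x = 0).
  split; first exact: rmorph0.
    by move=> x y rx ry; rewrite rmorphD rx ry addr0.
  by move=> a x rx; rewrite rmorphM rx mulr0.
have rw : res w = 0 by apply/wP; exists 1; rewrite mul1r.
have w0 : w != 0.
  apply: contraNneq x0_neq0 => w0; have [|b ->] := (wP x0).1; last by rewrite w0 mulr0.
  by apply/eqP; apply: contra_notT x0_nu => /unitR.
exists w; split=> // [x x_neq0|x /wP[b ->]]; last by exists 1%N, b.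
(* The saturation of the ideal of [x] by the powers of [w] has a generator [b]. If [w] divided [b],
   the quotient would lie in the saturation and [w] would be a unit; so [b] is a unit and [x]
   divides a power of [w]. *)
have [|b bP] := R_pid (fun y => exists n c, w ^+ n * y = c * x).
  split; first by exists 0%N, 0; rewrite mulr0 mul0r.
    move=> y z [n [c Ey]] [m [d Ez]]; exists (n + m)%N, (w ^+ m * c + w ^+ n * d).
    rewrite mulrDr mulrDl exprD -!mulrA -Ey -Ez; ring.
  by move=> a y [n [c Ey]]; exists n, (a * c); rewrite mulrCA Ey mulrA.
have b0 : b != 0.
  have [|c Ec] := (bP x).1; first by exists 0%N, 1.
  by apply: contraNneq x_neq0 => b0; rewrite Ec b0 mulr0.
have [n [c Eb]] : exists n c, w ^+ n * b = c * x by apply/bP; exists 1; rewrite mul1r.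
have [/wP[b' Eb']|/unitR[d bd]] := eqVneq (res b) 0.
  have [|d Ed] := (bP b').1.
    by exists n.+1, c; rewrite exprSr -mulrA [w * _]mulrC -Eb'.
  have /(mulIf b0) E1 : (d * w) * b = 1 * b by rewrite mul1r [RHS]Eb' Ed; ring.
  by move/eqP: (congr1 res E1); rewrite rmorphM rw mulr0 rmorph1 eq_sym oner_eq0.
by exists n, (c * d); rewrite mulrAC -Eb -mulrA bd mulr1.
Qed.

(** * Nonvanishing of [p] in the Witt vectors *)

Section WittCharacteristic.
Variables (p : nat) (p_pr : prime p).

Lemma ghost_natr (A : comNzRingType) n m : ghost p (n%:R : witt p_pr A) m = n%:R.
Proof.
elim: n => [|n IHn]; first exact: ghost_zero.
rewrite !mulrS -IHn.
by rewrite [LHS](ghost_add (1 : witt p_pr A) (n%:R)) [X in X + _]ghost_one.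
Qed.

Lemma witt_map_natr (A B : comNzRingType) (f : {rmorphism A -> B}) n :
  witt_map f (n%:R : witt p_pr A) = (n%:R : witt p_pr B).
Proof.
elim: n => [|n IHn]; first exact: witt_map_zero.
rewrite !mulrS -IHn [LHS](witt_map_add f (1 : witt p_pr A) n%:R).
by congr (witt_add _ _); exact: witt_map_one.
Qed.

(** The component of index 1 of the Witt vector [p] is [1 - p ^ (p - 1)]. *)
Lemma witt_natp_neq0 (A : comNzRingType) : p \in [pchar A] -> p%:R != 0 :> witt p_pr A.
Proof.
move=> char_A; apply/eqP => p0.
pose y : witt p_pr int := p%:R.
have Ey0 : y 0%N = p%:R.
  by rewrite -(ghost_natr int p 0) /ghost big_ord1 mul1r expr1.
have p_gt0 := prime_gt0 p_pr.
have Ey1 : y 1%N = 1 - p%:R ^+ p.-1.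
  have pz : p%:R != 0 :> int by rewrite Num.Theory.pnatr_eq0 -lt0n.
  apply: (mulfI pz); have := ghost_natr int p 1.
  rewrite /ghost big_ord_recl big_ord1 /= mul1r expr1 -[(p%:R : witt p_pr int)]/y Ey0.
  rewrite /bump /= subn0 addn0 !expn1 mulrBr mulr1 -exprS prednK // => {2}<-.
  by rewrite addrC addKr.
have := congr1 (fun x : witt p_pr A => x 1%N) (witt_map_natr intr p).
rewrite p0 -[LHS]/(intr (y 1%N)) Ey1 rmorphB rmorphXn rmorph1 rmorph_nat (pcharf0 char_A).
rewrite expr0n -leqn0 leqNgt -ltnS prednK // prime_gt1 // subr0 => /eqP.
by rewrite oner_eq0.
Qed.

End WittCharacteristic.

Lemma fermat_natr (K : fieldType) p n : p \in [pchar K] -> (n%:R : K) ^+ p = n%:R.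
Proof. by move=> char_K; rewrite -(pFrobenius_autE char_K) rmorph_nat. Qed.

(** The [p] elements of the prime field already exhaust the roots of ['X^p - 'X]. *)
Lemma fermat_root (K : fieldType) p (x : K) : p \in [pchar K] -> x ^+ p = x ->
  exists n, x = n%:R.
Proof.
move=> char_K xp; have p_pr := pcharf_prime char_K.
pose zs := [seq n%:R : K | n <- iota 0 p].
have [/mapP[n _ ->]|x_zs] := boolP (x \in zs); first by exists n.
have size_P : size ('X^p - 'X : {poly K}) = p.+1.
  by rewrite size_polyDl size_polyXn // size_polyN size_polyX ltnS prime_gt1.
have P0 : 'X^p - 'X != 0 :> {poly K} by rewrite -size_poly_gt0 size_P.
have uniq_rs : uniq (x :: zs).
  rewrite /= x_zs map_inj_in_uniq ?iota_uniq // => n m.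
  by rewrite !mem_iota !add0n /=; apply: natr_pchar_inj.
suff /max_poly_roots/(_ uniq_rs) : all (root ('X^p - 'X)) (x :: zs).
  by move=> /(_ P0); rewrite size_P /= size_map size_iota ltnn.
apply/andP; split; first by rewrite rootE !hornerE xp subrr.
by apply/allP => _ /mapP[n _ ->]; rewrite rootE !hornerE fermat_natr // subrr.
Qed.

Lemma ps_divX (A : comNzRingType) n (f : pseries A) :
  (forall m, (m < n)%N -> f m = 0) -> exists e, f = psX A ^+ n * e /\ e 0%N = f n.
Proof.
elim: n f => [|n IHn] f f_low; first by exists f; rewrite mul1r.
have [m lt_mn|e [Ee e0]] := IHn (ps_shift f); first exact: (f_low m.+1).
exists e; split=> //; rewrite exprS -mulrA -Ee.
by rewrite {1}[f]ps_decomp f_low // rmorph0 add0r.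
Qed.

Lemma coefpsXnM (A : comNzRingType) n (f : pseries A) : (psX A ^+ n * f) n = f 0%N.
Proof.
elim: n => [|n IHn]; first by rewrite mul1r.
by rewrite exprS -mulrA coefpsXM.
Qed.

Section LeadingCoefficient.
Variables (k : fieldType) (G : finGroupType) (sigma : ps_aut_group G k).
Variable p : nat.
Hypothesis p_pr : prime p.
Hypothesis displ_low : forall g n, (n < p)%N -> displ sigma g n = 0.

Definition lead g : k := displ sigma g p.

(** The displacement of [g * h] is that of [g] plus the image under [g] of that of [h]. As [g]
    multiplies the variable by a series with constant term 1, it preserves the coefficient of index
    [p] of the latter. *)
Lemma leadM g h : lead (g * h)%g = lead g + lead h.
Proof.
have act0 f : pact sigma g f 0%N = f 0%N.
  exact: (@pact_res k k idfun G sigma p p_pr displ_low g f).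
have [n lt_np|e [Ee e0]] := @ps_divX _ p (displ sigma h); first exact: displ_low.
have [u [Eu u0]] : exists u, pact sigma g (psX k) = psX k * u /\ u 0%N = 1.
  exists (1 + ps_shift (displ sigma g)); split.
    rewrite displE {1}[displ sigma g]ps_decomp displ_low ?prime_gt0 // rmorph0.
    by rewrite add0r [RHS]mulrDr; congr (_ + _); exact: esym (mulr1 _).
  rewrite -[LHS]/(1 + displ sigma g 1%N) displ_low ?prime_gt1 //.
  exact: addr0.
have -> : lead (g * h)%g = (displ sigma g + pact sigma g (displ sigma h)) p.
  apply: (congr1 (fun f : pseries k => f p)).
  by rewrite /displ pactM rmorphB; ring.
congr (_ + _); rewrite Ee rmorphM rmorphXn Eu exprMn -mulrA coefpsXnM ps_const0M.
have -> : (u ^+ p) 0%N = 1.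
  by rewrite -[LHS]/(ps_const (u ^+ p)) rmorphXn -[X in X ^+ _]/(u 0%N) u0 expr1n.
by rewrite act0 e0 mul1r.
Qed.

End LeadingCoefficient.

Section ElementaryAbelian.
Variables (p : nat) (p_pr : prime p).

Lemma expg_ZpZp (x y : 'Z_p) n : ((x, y) ^+ n)%g = (x *+ n, y *+ n).
Proof.
elim: n => [|n IHn] //; rewrite expgS IHn !mulrS.
by [].
Qed.

Lemma exponent_ZpZp (g : 'Z_p * 'Z_p) : (g ^+ p)%g = 1%g.
Proof.
have p0 : p%:R = 0 :> 'Z_p by rewrite pchar_Zp ?prime_gt1.
by case: g => x y; rewrite expg_ZpZp -(mulr_natr x) -(mulr_natr y) p0 !mulr0.
Qed.

Lemma commute_ZpZp (g h : 'Z_p * 'Z_p) : (g * h)%g = (h * g)%g.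
Proof.
case: g h => [x y] [z t].
by rewrite -[LHS]/(x + z, y + t) -[RHS]/(z + x, t + y) [x + z]addrC [y + t]addrC.
Qed.

End ElementaryAbelian.

Lemma fermat_unit (K : fieldType) p (x : K) : (0 < p)%N -> x != 0 ->
  (x ^+ p.-1 == 1) = (x ^+ p == x).
Proof.
move=> p0 x0; rewrite -[in RHS](prednK p0) exprSr -[RHS]subr_eq0.
by rewrite -[X in _ - X == 0]mul1r -mulrBl mulf_eq0 (negPf x0) orbF subr_eq0.
Qed.

(** The values [a g ^ (p - 1)] on the [p] lines spanned by the [(1, c)] are
    distinct, and their ratios to [a (0, 1) ^ (p - 1)] would be [p] roots of
    [X ^ (p - 2) - 1]. *)
Lemma no_constant_leading_power (K : fieldType) p (a : 'Z_p * 'Z_p -> K) :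
    prime p -> (2 < p)%N -> p \in [pchar K] ->
    (forall g h, a (g * h)%g = a g + a h) -> (forall g, g != 1%g -> a g != 0) ->
    (forall s t, (forall n, s <> (t ^+ n)%g) -> (forall n, t <> (s ^+ n)%g) ->
      exists h, a t ^+ p.-2 = h%:R * a s ^+ p.-2) ->
  False.
Proof.
move=> p_pr p_gt2 char_K aM a_neq0 ratio.
have p_gt0 := prime_gt0 p_pr.
pose t : 'Z_p * 'Z_p := (0, 1); pose s c : 'Z_p * 'Z_p := (1, c%:R).
have a1 : a 1%g = 0 by apply: (addrI (a 1%g)); rewrite -aM mulg1 addr0.
have aX g n : a (g ^+ n)%g = n%:R * a g.
  elim: n => [|n IHn]; first by rewrite expg0 a1 mul0r.
  by rewrite expgS aM IHn mulrS mulrDl mul1r.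
have a_inj g h : a g = a h -> g = h.
  move=> gh; apply/eqP; rewrite eq_mulgV1; apply: contraT => /a_neq0.
  by rewrite aM gh -aM mulgV a1 eqxx.
have t1 : t != 1%g by apply/eqP => -[/eqP]; rewrite oner_eq0.
have s1 c : s c != 1%g by apply/eqP => -[/eqP]; rewrite oner_eq0.
have st c n : s c <> (t ^+ n)%g.
  by rewrite expg_ZpZp => -[/eqP + _]; rewrite mul0rn oner_eq0.
have ts c n : t <> (s c ^+ n)%g.
  by rewrite expg_ZpZp => -[n0 /eqP]; rewrite mulrnAC -n0 mul0rn oner_eq0.
pose x c := (a (s c) / a t) ^+ p.-1.
have x_root c : x c ^+ p.-2 = 1.
  have [h Eh] := ratio (s c) t (st c) (ts c).
  have h0 : h%:R != 0 :> K.
    apply: contraNneq (expf_neq0 p.-2 (a_neq0 t t1)) => h0.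
    by rewrite Eh h0 mul0r.
  have -> : x c ^+ p.-2 = (h%:R^-1) ^+ p.-1.
    rewrite /x exprAC; congr (_ ^+ _); rewrite expr_div_n Eh invfM.
    by rewrite mulrCA divff ?mulr1 // expf_neq0 ?a_neq0.
  by rewrite exprVn; apply/eqP; rewrite invr_eq1 fermat_unit // fermat_natr.
have x_inj : {in iota 0 p &, injective x}.
  move=> c d; rewrite !mem_iota !add0n /= => lt_c lt_d; rewrite /x !expr_div_n.
  move/(mulIf (invr_neq0 (expf_neq0 _ (a_neq0 t t1)))) => Ecd.
  (* The ratio is a root of unity of order dividing [p - 1], hence lies in the prime field; so [s c]
     is a power of [s d], and the first components force exponent 1 modulo [p]. *)
  have [n En] : exists n, a (s c) / a (s d) = n%:R.
    apply: (fermat_root char_K); apply/eqP; rewrite -fermat_unit //; last first.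
      by rewrite mulf_neq0 ?invr_neq0 ?a_neq0.
    by rewrite expr_div_n Ecd divff // expf_neq0 ?a_neq0.
  have : s c = (s d ^+ n)%g.
    by apply: a_inj; rewrite aX -En divfK ?a_neq0.
  rewrite expg_ZpZp => -[n1]; rewrite mulrnAC -n1.
  by move=> /(congr1 val) /=; rewrite !val_Zp_nat ?prime_gt1 // !modn_small.
have p2_gt0 : (0 < p.-2)%N by rewrite -subn2 subn_gt0.
have := @max_unity_roots _ p.-2 [seq x c | c <- iota 0 p] p2_gt0.
rewrite map_inj_in_uniq // iota_uniq size_map size_iota => le_p.
have : (p <= p.-2)%N.
  by apply: le_p => //; apply/allP => _ /mapP[c _ ->]; rewrite unity_rootE x_root.
by rewrite leqNgt -subn2 ltn_subrL p_gt0.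
Qed.

Theorem theorem2p13 (p : nat) (p_pr : prime p) (p_ge3 : (3 <= p)%N)
    (k : closedFieldType) (char_k : p \in [pchar k])
    (R : idomainType) (R_dvr : is_dvr R)
    (iota : {rmorphism witt p_pr k -> R}) (R_dom_W : dominates iota)
    (kappa : fieldType) (res : {rmorphism R -> kappa})
    (res_kappa : is_residue_field res)
    (j : {rmorphism k -> kappa})
    (res_iota : forall w : witt p_pr k, res (iota w) = j (witt_res w))
    (sigma : ps_aut_group ('Z_p * 'Z_p)%type k)
    (conductors : forall g : 'Z_p * 'Z_p, g != 1%g ->
       ps_val (sigma g (psX k) - psX k) = Some p) :
  ~ exists Sigma : ps_aut_group ('Z_p * 'Z_p)%type R,
      reduces_to res j Sigma sigma.
Proof.
move=> [Sigma red].
have low_k g n : (n < p)%N -> displ sigma g n = 0.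
  have [->|/conductors/ps_valP[_ lo]] := eqVneq g 1%g; last exact: lo.
  by rewrite /displ pact1 subrr.
have lead_neq0 g : g != 1%g -> lead sigma p g != 0.
  by move=> /conductors/ps_valP[].
have res_displ g n : res (displ Sigma g n) = j (displ sigma g n).
  have EX : ps_map res (psX R) = ps_map j (psX k).
    exact: etrans (ps_mapX res) (esym (ps_mapX j)).
  have Eg := congr1 (fun f : pseries kappa => f n) (red g _ _ EX).
  have EXn := congr1 (fun f : pseries kappa => f n) EX.
  rewrite [LHS](rmorphB res (Sigma g (psX R) n) (psX R n)).
  rewrite [RHS](rmorphB j (sigma g (psX k) n) (psX k n)).
  by congr (_ - _).
have low_R g n : (n < p)%N -> res (displ Sigma g n) = 0.
  by move=> lt_np; rewrite res_displ low_k // rmorph0.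
have lead_R g : g != 1%g -> res (displ Sigma g p) != 0.
  by move=> /lead_neq0; rewrite res_displ fmorph_eq0.
(* The residue field has characteristic [p], while [p] is nonzero in [R], which contains the Witt
   vectors. *)
have char_kappa : p \in [pchar kappa] by rewrite (rmorph_pchar j char_k).
have pR : p%:R != 0 :> R.
  rewrite -(rmorph_nat iota); apply: contraNneq (witt_natp_neq0 p_pr char_k).
  have [iota_inj _] := R_dom_W.
  by rewrite -(rmorph0 iota) => /iota_inj ->.
have [w R_tame] := dvr_tame R_dvr res_kappa.
apply: (@no_constant_leading_power kappa p (j \o lead sigma p)) => //.
- by move=> g h /=; rewrite (leadM p_pr low_k) rmorphD.
- by move=> g /lead_neq0; rewrite /= fmorph_eq0.
move=> s t st ts.
have s1 : s != 1%g by apply/eqP => s1; apply: (st 0%N); rewrite expg0.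
have t1 : t != 1%g by apply/eqP => t1; apply: (ts 0%N); rewrite expg0.
have [D [rho [i [phi [psi [D_tame rho_i ptphi ptpsi [fs ft]]]]]]] :=
  two_points R_tame (prime_gt0 p_pr) (@low_R s) (lead_R s s1) (@low_R t) (lead_R t t1).
(* In [R], [p] divides a power of [w], and the image of [w] in [D] is nonzero. *)
have pD : p%:R != 0 :> D.
  have [_ _ divR _] := R_tame; have [n [y Ey]] := divR _ pR.
  have [[iw0 _] _ _ _] := D_tame.
  apply: contraNneq (expf_neq0 n iw0) => pD.
  by rewrite -rmorphXn Ey rmorphM rmorph_nat pD mulr0.
have common (phi' : {rmorphism pseries R -> D}) : disc_point res rho i phi' ->
    fixes Sigma phi' s -> fixes Sigma phi' t -> False.
  move=> pt' fs' ft'.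
  exact: (no_common_fixed_point D_tame p_pr low_R lead_R pD (@exponent_ZpZp p p_pr)
    pt' t1 st fs' ft').
have t0 : phi (displ Sigma t) != 0 by apply/eqP => /(common _ ptphi fs).
have s0 : psi (displ Sigma s) != 0.
  by apply/eqP => fs'; exact: common ptpsi fs' ft.
have [h] := lead_ratio D_tame rho_i p_pr p_ge3 low_R lead_R char_kappa
  (@exponent_ZpZp p p_pr) (@commute_ZpZp p) ptphi ptpsi fs ft t0 s0.
by rewrite !res_displ => Eh; exists h.
Qed.
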